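(* Let $n\ge 2$ and let $\chi$ be a character of $B(\mathcal{O}/\mathfrak{m}^n)$. For each $\beta=(\beta_0,\dots,\beta_{f-1})\in S$, the subspace $W_\beta$ of $I_n(\chi)$ is a $\mathrm{GL}_2(\mathcal{O}/\mathfrak{m}^n)$-submodule of $I_n(\chi)$. Moreover, there is an isomorphism of $\mathrm{GL}_2(\mathcal{O}/\mathfrak{m}^n)$-modules $$ W_\beta \Big/ \sum_{\alpha\in S,\ \alpha\prec\beta} W_\alpha \;\simeq\; I_{n-1}\bigl(\chi\cdot\eta^{\sum_{i=0}^{f-1}\beta_i p^i}\bigr),$$ where $\mathrm{GL}_2(\mathcal{O}/\mathfrak{m}^n)$ acts on the right-hand side via its natural projection to $\mathrm{GL}_2(\mathcal{O}/\mathfrak{m}^{n-1})$.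
   Context: Let $p$ be an odd prime, $F/\mathbb{Q}_p$ a finite extension with valuation ring $\mathcal{O}$, maximal ideal $\mathfrak{m}$, uniformizer $\varpi$, and residue field $k$ of cardinality $q=p^f$. All representations are over an extension field $E$ of $k$. $B\le \mathrm{GL}_2$ is the subgroup of upper triangular matrices. For $x\in k$, $[x]\in\mathcal{O}$ is the Teichmüller lift; every $\lambda\in\mathcal{O}/\mathfrak{m}^n$ is written uniquely as $\lambda=\sum_{i=0}^{n-1}[\lambda_i]\varpi^i$ with $\lambda_i\in k$. Every character $\chi$ of $B(\mathcal{O}/\mathfrak{m}^n)$ with values in $E^\times$ factors through $B(k)$, takes values in $k^\times$, and is viewed as a character of $B(\mathcal{O}/\mathfrak{m}^m)$ for every $m\ge1$. Let $\eta:B(k)\to k^\times$ be $\begin{pmatrix} a&b\\0&d\end{pmatrix}\mapsto ad^{-1}$. Set $I_n(\chi)=\mathrm{Ind}_{B(\mathcal{O}/\mathfrak{m}^n)}^{\mathrm{GL}_2(\mathcal{O}/\mathfrak{m}^n)}\chi$, the space of functions $\varphi:\mathrm{GL}_2(\mathcal{O}/\mathfrak{m}^n)\to E$ with $\varphi(bg)=\chi(b)\varphi(g)$ for $b\in B(\mathcal{O}/\mathfrak{m}^n)$, with the group acting by right translation. Write $\chi=\det^s\cdot\chi_r$ with unique $s,r\in\mathbb{Z}/(q-1)\mathbb{Z}$, where $\det$ is followed by reduction to $k^\times$ and $\chi_r\begin{pmatrix} a&b\\0&d\end{pmatrix}=(d \bmod \mathfrak{m})^r$. Identify $I_n(\chi)$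 with $\det^s\otimes I_n(\chi_r)$ via $\det(g)^s\varphi(g)\leftrightarrow\varphi(g)$. For $g\in\mathrm{GL}_2(\mathcal{O}/\mathfrak{m}^n)$ and $v\in E$, let $g\otimes v\in I_n(\chi_r)$ be the function supported on $B(\mathcal{O}/\mathfrak{m}^n)g^{-1}$ with value $\chi_r(b)v$ at $bg^{-1}$. Let $S=\{0,1,\dots,p-1\}^f$, partially ordered by $(a_0,\dots,a_{f-1})\preceq(b_0,\dots,b_{f-1})$ iff $a_i\le b_i$ for all $i$; $\prec$ is the strict order. For $x\in k$ and $a\in S$ put $x^a=x^{\sum_i a_ip^i}$, with $0^0=1$. For $\mathbf{j}=(j_0,\dots,j_{n-1})\in S^n$ put $$f_{\mathbf{j}}=\sum_{\lambda\in\mathcal{O}/\mathfrak{m}^n}\begin{pmatrix}\lambda&1\\1&0\end{pmatrix}\otimes\lambda_0^{j_0}\cdots\lambda_{n-1}^{j_{n-1}}\in I_n(\chi_r),$$ and for $(j_1,\dots,j_{n-1})\in S^{n-1}$ put $f_{(\infty,j_1,\dots,j_{n-1})}=w\,f_{(0,j_1,\dots,j_{n-1})}$, where $w=\begin{pmatrix}0&1\\1&0\end{pmatrix}$ and the action is that on $I_n(\chi_r)$. These elements form a basis of $I_n(\chi_r)$, hence (under the identification above) of $I_n(\chi)$. For $\beta\in S$, $W_\beta$ is the linear span of all $f_{(j_0,\dots,j_{n-1})}$ and $f_{(\infty,j_1,\dots,j_{n-1})}$ with $j_0,\dots,j_{n-2}\in S$ and $j_{n-1}\in S$, $j_{n-1}\preceq\beta$.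 *)

(* Defs.v *)
From HB Require Import structures.
From mathcomp Require Import all_boot all_order all_algebra all_fingroup all_field.
From mathcomp Require Import generic_quotient ring_quotient.
From mathcomp Require Import boolp.

Set Implicit Arguments.
Unset Strict Implicit.
Unset Printing Implicit Defensive.

Import Order.TTheory GRing.Theory Num.Theory.
Local Open Scope ring_scope.

(* Z_p is the inverse limit of the rings Z/p^n; the residue class modulo p^n
   is represented by its least nonnegative element.  The proof that p is prime
   is a parameter of the type, so that Z_p is canonically a domain. *)
Record padic_int (p : nat) (pr_p : prime p) := PadicInt {
  zp_val :> nat -> int;
  zp_valP : forall n, zp_val n = (zp_val n.+1 %% (p ^ n)%N%:Z)%Z
}.

Section PadicInt.
Variables (p : nat) (pr_p : prime p).
Local Notation Zp := (padic_int pr_p).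
Local Notation P n := ((p ^ n)%N%:Z).

HB.instance Definition _ := gen_eqMixin Zp.
HB.instance Definition _ := gen_choiceMixin Zp.

Lemma zp_inj (x y : Zp) : (forall n, x n = y n) -> x = y.
Proof.
case: x y => [x xP] [y yP] /= /funext exy; case: y / exy yP => yP.
by congr PadicInt; apply: Prop_irrelevance.
Qed.

Lemma Pneq0 n : P n != 0.
Proof. by rewrite eqz_nat expn_eq0 negb_and -lt0n prime_gt0. Qed.

Lemma zp_modn (x : Zp) n : (x n %% P n)%Z = x n.
Proof. by rewrite {1}zp_valP modz_mod -zp_valP. Qed.

Lemma modz_dvd_mod (a : int) n : ((a %% P n.+1)%Z %% P n)%Z = (a %% P n)%Z.
Proof.
by rewrite expnS PoszM [in RHS](divz_eq a (p%:Z * P n)) mulrA modzMDl.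
Qed.

Fact zp_cst_subproof (a : int) n : (a %% P n)%Z = ((a %% P n.+1)%Z %% P n)%Z.
Proof. by rewrite modz_dvd_mod. Qed.
Definition zp_of_int a : Zp := PadicInt pr_p (zp_cst_subproof a).

Fact zp_opp_subproof (x : Zp) n :
  (- x n %% P n)%Z = ((- x n.+1 %% P n.+1)%Z %% P n)%Z.
Proof. by rewrite modz_dvd_mod {1}zp_valP modzNm. Qed.
Definition zp_opp x : Zp := PadicInt pr_p (zp_opp_subproof x).

Fact zp_add_subproof (x y : Zp) n :
  ((x n + y n) %% P n)%Z = (((x n.+1 + y n.+1) %% P n.+1)%Z %% P n)%Z.
Proof. by rewrite modz_dvd_mod !(zp_valP _ n) modzDm. Qed.
Definition zp_add x y : Zp := PadicInt pr_p (zp_add_subproof x y).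

Fact zp_mul_subproof (x y : Zp) n :
  ((x n * y n) %% P n)%Z = (((x n.+1 * y n.+1) %% P n.+1)%Z %% P n)%Z.
Proof. by rewrite modz_dvd_mod !(zp_valP _ n) modzMm. Qed.
Definition zp_mul x y : Zp := PadicInt pr_p (zp_mul_subproof x y).

Fact zp_addA : associative zp_add.
Proof. by move=> x y z; apply: zp_inj => n /=; rewrite modzDml modzDmr addrA. Qed.
Fact zp_addC : commutative zp_add.
Proof. by move=> x y; apply: zp_inj => n /=; rewrite addrC. Qed.
Fact zp_add0 : left_id (zp_of_int 0) zp_add.
Proof. by move=> x; apply: zp_inj => n /=; rewrite modzDml add0r zp_modn. Qed.
Fact zp_addN : left_inverse (zp_of_int 0) zp_opp zp_add.
Proof. by move=> x; apply: zp_inj => n /=; rewrite modzDml addNr. Qed.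
HB.instance Definition _ :=
  GRing.isZmodule.Build Zp zp_addA zp_addC zp_add0 zp_addN.

Fact zp_mulA : associative zp_mul.
Proof. by move=> x y z; apply: zp_inj => n /=; rewrite modzMml modzMmr mulrA. Qed.
Fact zp_mulC : commutative zp_mul.
Proof. by move=> x y; apply: zp_inj => n /=; rewrite mulrC. Qed.
Fact zp_mul1 : left_id (zp_of_int 1) zp_mul.
Proof. by move=> x; apply: zp_inj => n /=; rewrite modzMml mul1r zp_modn. Qed.
Fact zp_mulD : left_distributive zp_mul zp_add.
Proof.
by move=> x y z; apply: zp_inj => n /=; rewrite modzMml mulrDl modzDm.
Qed.
Fact zp_one_neq0 : zp_of_int 1 != zp_of_int 0.
Proof.
apply/eqP=> /(congr1 (fun x : Zp => x 1%N)) /= /eqP.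
by rewrite expn1 mod0z modz_small ?ltz_nat ?prime_gt1.
Qed.
HB.instance Definition _ :=
  GRing.Zmodule_isComNzRing.Build Zp zp_mulA zp_mulC zp_mul1 zp_mulD zp_one_neq0.

Definition zp_unit : {pred Zp} := fun x => `[< exists y : Zp, y * x = 1 >].
Definition zp_inv (x : Zp) : Zp :=
  if pselect (exists y : Zp, y * x = 1) is left h then projT1 (cid h) else x.

Fact zp_mulV : {in zp_unit, left_inverse 1 zp_inv *%R}.
Proof.
by move=> x /asboolP h; rewrite /zp_inv; case: pselect => // h'; case: cid.
Qed.
Fact zp_unitP (x y : Zp) : y * x = 1 -> zp_unit x.
Proof. by move=> h; apply/asboolP; exists y. Qed.
Fact zp_invr_out : {in [predC zp_unit], zp_inv =1 id}.
Proof. by move=> x /asboolP h; rewrite /zp_inv; case: pselect. Qed.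
HB.instance Definition _ :=
  GRing.ComNzRing_hasMulInverse.Build Zp zp_mulV zp_unitP zp_invr_out.

Lemma zp_mod_le (x : Zp) m n : (m <= n)%N -> (x n %% P m)%Z = x m.
Proof.
move=> /subnK <-; elim: (n - m)%N => [|d IHd]; first exact: zp_modn.
rewrite addSn -[in RHS]IHd (zp_valP x (d + m)) expnD PoszM.
by rewrite [in LHS](divz_eq (x (d + m).+1) (P d * P m)) mulrA modzMDl.
Qed.

Lemma zp_neq0 (x : Zp) : x != 0 -> exists n, x n != 0.
Proof.
move=> x0; apply: contrapT => h; case/eqP: x0; apply: zp_inj => n /=.
by rewrite mod0z; apply/eqP/negPn/negP => xn; apply: h; exists n.
Qed.

Fact zp_integral : GRing.integral_domain_axiom Zp.
Proof.
move=> x y xy0; apply/norP => -[/zp_neq0[a xa] /zp_neq0[b yb]].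
have ndvd (z : Zp) m n : z m != 0 -> (m <= n)%N -> ~~ (P m %| z n)%Z.
  move=> zm /(zp_mod_le z) e; apply: contra zm => /dvdz_mod0P.
  by rewrite e => ->.
have le1 : (a <= a + b)%N := leq_addr _ _; have le2 : (b <= a + b)%N := leq_addl _ _.
have := ndvd x _ _ xa le1; have := ndvd y _ _ yb le2.
have : (P (a + b) %| x (a + b)%N * y (a + b)%N)%Z.
  apply/dvdz_mod0P; have := congr1 (fun z : Zp => z (a + b)%N) xy0.
  by rewrite /= mod0z.
rewrite !dvdzE abszM !absz_nat.
set u := absz _; set v := absz _ => uv hv hu.
have u0 : (0 < u)%N by rewrite lt0n; apply: contra hu => /eqP ->.
have v0 : (0 < v)%N by rewrite lt0n; apply: contra hv => /eqP ->.
move: uv hu hv; rewrite !pfactor_dvdn ?muln_gt0 ?u0 // lognM // -!ltnNge => h hu hv.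
by have := leq_ltn_trans h (leq_add hu (ltnW hv)); rewrite ltnn.
Qed.
HB.instance Definition _ := GRing.ComUnitRing_isIntegral.Build Zp zp_integral.

Definition padic : fieldType := {fraction Zp}.

End PadicInt.

(* Normalized discrete valuation; the value at 0, which should be +oo, is
   irrelevant and all uses below treat 0 separately. *)
Record valuation (F : fieldType) := Valuation {
  valn :> F -> int;
  valnM : forall x y, x != 0 -> y != 0 -> valn (x * y) = valn x + valn y;
  valnD : forall x y, x != 0 -> y != 0 -> x + y != 0 ->
    Num.min (valn x) (valn y) <= valn (x + y);
  valn_surj : exists2 x, x != 0 & valn x = 1
}.

Section ValuationRing.
Variables (F : fieldType) (v : valuation F).

Definition in_vring : {pred F} := fun x => (x == 0) || (0 <= v x).

Fact in_vring_subring : subring_closed in_vring.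
Proof.
have v1 : v 1 = 0.
  have := valnM v (oner_neq0 F) (oner_neq0 F).
  by rewrite mulr1 => /eqP; rewrite -subr_eq subrr eq_sym => /eqP.
have vN1 : v (-1) = 0.
  have N1 : -1 != 0 :> F by rewrite oppr_eq0 oner_neq0.
  have /eqP := valnM v N1 N1.
  by rewrite mulrNN mulr1 v1 -mulr2n eq_sym mulrn_eq0 /= => /eqP.
have vM x y : x \in in_vring -> y \in in_vring -> x * y \in in_vring.
  rewrite !unfold_in mulf_eq0; have [//|x0] := eqVneq x 0.
  have [|y0] := eqVneq y 0; first by rewrite orbT.
  by rewrite /= valnM //; apply: addr_ge0.
split=> // [|x y]; first by rewrite unfold_in v1 orbT.
move=> hx hy; have {hy} : - y \in in_vring.
  by rewrite -mulN1r vM // unfold_in vN1 orbT.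
move: (- y) => z; move: hx; rewrite !unfold_in.
have [-> _|x0 /=] := eqVneq x 0; first by rewrite add0r.
have [-> |z0 /= hx hz] := eqVneq z 0; first by rewrite addr0 => ->; rewrite orbT.
have [//|xz0 /=] := eqVneq (x + z) 0.
by apply: le_trans (valnD v x0 z0 xz0); rewrite le_min hx hz.
Qed.
HB.instance Definition _ := GRing.isSubringClosed.Build F in_vring in_vring_subring.

Record vring := VRing { vring_val :> F; vringP : vring_val \in in_vring }.
HB.instance Definition _ := [isSub for vring_val].
HB.instance Definition _ := [Choice of vring by <:].
HB.instance Definition _ := [SubChoice_isSubComNzRing of vring by <:].

(* The n-th power of the maximal ideal consists of the x with v(x) >= n. *)
Definition in_mpow n : {pred vring} :=
  fun x => (x == 0) || (n%:Z <= v (vring_val x)).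

(* pi presents A as the quotient of the valuation ring by m^n. *)
Definition is_quotient (A : pzRingType) (n : nat) (pi : {rmorphism vring -> A}) :=
  (forall a, exists x, pi x = a) /\ (forall x, (pi x == 0) = (x \in in_mpow n)).

(* The Teichmuller lift of x is the unique root of X^q - X lifting x. *)
Definition is_teichmuller (k : finFieldType) (pik : {rmorphism vring -> k})
    (teich : k -> vring) :=
  forall x, pik (teich x) = x /\ teich x ^+ #|k| = teich x.

End ValuationRing.

Record gmod (G : finGroupType) (E : fieldType) := GMod {
  gcarrier :> lmodType E;
  gact : G -> gcarrier -> gcarrier;
  gact_linear : forall g, linear (gact g);
  gact1 : forall u, gact 1%g u = u;
  gactM : forall g h u, gact (g * h)%g u = gact g (gact h u)
}.

Definition gmod_iso (G : finGroupType) (E : fieldType) (M N : gmod G E) :=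
  exists f : {linear M -> N},
    bijective f /\ forall g u, f (gact g u) = gact g (f u).

Section Inflation.
Variables (G H : finGroupType) (E : fieldType) (h : G -> H).
Hypotheses (h1 : h 1%g = 1%g) (hM : {morph h : x y / (x * y)%g}).
Variable M : gmod H E.

Fact infl_act1 (u : M) : gact (h 1%g) u = u.
Proof. by rewrite h1 gact1. Qed.
Fact infl_actM g1 g2 (u : M) : gact (h (g1 * g2)%g) u = gact (h g1) (gact (h g2) u).
Proof. by rewrite hM gactM. Qed.

Definition inflation : gmod G E :=
  GMod (fun g => gact_linear (h g)) infl_act1 infl_actM.

End Inflation.

(* The vector space U / (U :&: V). *)
Section QuotientSpace.
Variables (E : fieldType) (vT : vectType E) (U V : {vspace vT}).

Definition in_sub : {pred subvs_of U} := fun u => vsval u \in V.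

Fact in_sub_submod : submod_closed in_sub.
Proof.
split=> [|a u w hu hw]; first by rewrite unfold_in linear0 mem0v.
by rewrite unfold_in linearP memvD // memvZ.
Qed.
HB.instance Definition _ :=
  GRing.isSubmodClosed.Build E (subvs_of U) in_sub in_sub_submod.

Definition quotv := Quotient.quot in_sub.
HB.instance Definition _ := GRing.Zmodule.on quotv.
HB.instance Definition _ := Quotient.on quotv.
Local Open Scope quotient_scope.

Lemma pi_quotv_eq (u w : subvs_of U) :
  (\pi_quotv u == \pi_quotv w) = (vsval u - vsval w \in V).
Proof. by rewrite -Quotient.idealrBE -linearB. Qed.

Definition quot_scale (a : E) (x : quotv) : quotv := \pi_quotv (a *: repr x).

Lemma pi_scale a u : \pi_quotv (a *: u) = quot_scale a (\pi_quotv u).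
Proof.
apply/eqP; rewrite pi_quotv_eq -linearB -scalerBr linearZ memvZ //.
by rewrite linearB -pi_quotv_eq reprK.
Qed.

Fact quot_scalerA a b x : quot_scale a (quot_scale b x) = quot_scale (a * b) x.
Proof. by rewrite -[x]reprK -!pi_scale scalerA !reprK. Qed.
Fact quot_scale1r : left_id 1 quot_scale.
Proof. by move=> x; rewrite -[x]reprK -!pi_scale scale1r. Qed.
Fact quot_scalerDr : right_distributive quot_scale +%R.
Proof.
move=> a x y; rewrite -[x]reprK -[y]reprK.
by rewrite -(raddfD \pi_quotv) -!pi_scale scalerDr raddfD.
Qed.
Fact quot_scalerDl x : {morph quot_scale^~ x : a b / a + b}.
Proof. by move=> a b; rewrite -[x]reprK -!pi_scale scalerDl raddfD. Qed.
HB.instance Definition _ := GRing.Zmodule_isLmodule.Build E quotv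
  quot_scalerA quot_scale1r quot_scalerDr quot_scalerDl.

Lemma pi_quotv_linear a u w :
  \pi_quotv (a *: u + w) = a *: \pi_quotv u + \pi_quotv w.
Proof. by rewrite raddfD; congr (_ + _); apply: pi_scale. Qed.

End QuotientSpace.

Section GL2.
Variable R : finComUnitRingType.
Local Notation GL := {'GL_2[R]}.

Definition borel : {set GL} := [set g : GL | GLval g 1 0 == 0].

Definition mx2 (a b c d : R) : 'M[R]_2 :=
  \matrix_(i, j) if i == 0 then (if j == 0 then a else b)
                 else (if j == 0 then c else d).

Fact mx_lam_unit (l : R) : mx2 l 1 1 0 \is a GRing.unit.
Proof.
have h : mx2 l 1 1 0 *m mx2 0 1 1 (- l) = 1%:M; last by case/mulmx1_unit: h.
apply/matrixP=> i j; rewrite !mxE !big_ord_recl big_ord0 !mxE /= addr0.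
case: i j => [[|[|?]] ?] [[|[|?]] ?] //=;
  by rewrite ?(mulr0, mulr1, mul1r, mul0r, addr0, add0r, subrr, addNr, addrN).
Qed.
Definition gl_lam (l : R) : GL := FinRing.Unit (mx_lam_unit l).
Definition gl_w : GL := gl_lam 0.

End GL2.

Section GLMap.
Variables (R R' : finComUnitRingType) (rho : {rmorphism R -> R'}).

Fact gl_map_unit (g : {'GL_2[R]}) : map_mx rho (GLval g) \is a GRing.unit.
Proof.
rewrite -[_ \is a GRing.unit]/(_ \in unitmx) unitmxE det_map_mx rmorph_unit //.
by rewrite -unitmxE; exact: (valP g).
Qed.
Definition gl_map (g : {'GL_2[R]}) : {'GL_2[R']} := FinRing.Unit (gl_map_unit g).

Lemma gl_map1 : gl_map 1%g = 1%g.
Proof. by apply: val_inj; rewrite /= map_mx1. Qed.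
Lemma gl_mapM : {morph gl_map : x y / (x * y)%g}.
Proof. by move=> x y; apply: val_inj; rewrite /= -[_ * _]/(_ *m _) map_mxM. Qed.

End GLMap.

Section Induced.
Variables (R : finComUnitRingType) (E : fieldType).
Local Notation GL := {'GL_2[R]}.

Definition glfun := {ffun GL -> E^o}.
HB.instance Definition _ := Vector.on glfun.

Definition rtrans (g : GL) (phi : glfun) : glfun := [ffun x => phi (x * g)%g].

Fact rtrans_linear g : linear (rtrans g).
Proof. by move=> a u w; apply/ffunP=> x; rewrite !ffunE. Qed.
Fact rtrans1 phi : rtrans 1%g phi = phi.
Proof. by apply/ffunP=> x; rewrite ffunE mulg1. Qed.
Fact rtransM g h phi : rtrans (g * h)%g phi = rtrans g (rtrans h phi).
Proof. by apply/ffunP=> x; rewrite !ffunE mulgA. Qed.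

(* Characters of the Borel subgroup are functions on GL_2 of which only the
   restriction to the Borel subgroup matters. *)
Definition is_bchar (chi : GL -> E) :=
  chi 1%g = 1 /\ {in borel R &, {morph chi : x y / (x * y)%g >-> x * y}}.

Section Ind.
Variable chi : GL -> E.

Definition in_ind : {pred glfun} := fun phi =>
  [forall b in borel R, forall g : GL, phi (b * g)%g == chi b * phi g].

Lemma in_indP (phi : glfun) :
  reflect (forall b g : GL, b \in borel R -> phi (b * g)%g = chi b * phi g)
          (phi \in in_ind).
Proof.
apply: (iffP forall_inP) => [h b g /h /forallP /(_ g) /eqP // | h b Bb].
by apply/forallP=> g; rewrite h.
Qed.

Fact in_ind_submod : subsemimod_closed in_ind.
Proof.
split=> [|a u /in_indP hu]; last first.
  by apply/in_indP=> b g Bb; rewrite !ffunE hu // /GRing.scale /= mulrCA.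
split=> [|u w /in_indP hu /in_indP hw]; apply/in_indP=> b g Bb.
  by rewrite !ffunE mulr0.
by rewrite !ffunE hu // hw // mulrDr.
Qed.

Record ind := Ind { ind_val :> glfun; indP : ind_val \in in_ind }.
HB.instance Definition _ := [isSub for ind_val].
HB.instance Definition _ := [Choice of ind by <:].
HB.instance Definition _ := GRing.SubChoice_isSubLmodule.Build E glfun in_ind ind
  in_ind_submod.

Fact ind_act_subproof g (u : ind) : rtrans g u \in in_ind.
Proof.
apply/in_indP=> b x Bb; rewrite !ffunE -mulgA.
by case: u => u hu; move/in_indP: (hu) => h; rewrite h.
Qed.
Definition ind_act g (u : ind) : ind := Ind (ind_act_subproof g u).
Fact ind_act_linear g : linear (ind_act g).
Proof. by move=> a u w; apply: val_inj; rewrite /= rtrans_linear. Qed.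
Fact ind_act1 u : ind_act 1%g u = u.
Proof. by apply: val_inj; rewrite /= rtrans1. Qed.
Fact ind_actM g h u : ind_act (g * h)%g u = ind_act g (ind_act h u).
Proof. by apply: val_inj; rewrite /= rtransM. Qed.

Definition ind_gmod : gmod GL E := GMod ind_act_linear ind_act1 ind_actM.

End Ind.

Definition gstable (U : {vspace glfun}) :=
  forall g phi, phi \in U -> rtrans g phi \in U.

Definition is_submodule_of_ind (chi : GL -> E) (U : {vspace glfun}) :=
  {subset U <= in_ind chi} /\ gstable U.

Lemma gstable_sum (I : finType) (P : pred I) (U : I -> {vspace glfun}) :
  (forall i, gstable (U i)) -> gstable (\sum_(i | P i) U i)%VS.
Proof.
move=> hU g phi /memv_sumP[u_ hu ->].
have -> : rtrans g (\sum_(i | P i) u_ i) = \sum_(i | P i) rtrans g (u_ i).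
  by apply/ffunP=> x; rewrite !(ffunE, sum_ffunE); apply: eq_bigr => i _; rewrite ffunE.
by apply: memv_sumr => i Pi; apply/hU/hu.
Qed.

(* The G-module U / (U :&: V). *)
Section SubQuotient.
Variables U V : {vspace glfun}.
Hypotheses (hU : gstable U) (hV : gstable V).
Local Notation Q := (quotv U V).
Local Open Scope quotient_scope.

Definition sub_act g (u : subvs_of U) : subvs_of U := Subvs (hU g (subvsP u)).
Definition subquot_act g (x : Q) : Q := \pi_Q (sub_act g (repr x)).

Lemma pi_sub_act g u : \pi_Q (sub_act g u) = subquot_act g (\pi_Q u).
Proof.
apply/eqP; rewrite pi_quotv_eq /=.
have /(_ (- 1) (vsval (repr (\pi_Q u))) (vsval u)) := rtrans_linear g.
rewrite !scaleN1r addrC => <-; apply: hV.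
by rewrite addrC -pi_quotv_eq reprK.
Qed.

Fact subquot_act_linear g : linear (subquot_act g).
Proof.
move=> a x y; rewrite -[x]reprK -[y]reprK.
rewrite -pi_quotv_linear -!pi_sub_act -pi_quotv_linear.
by congr (\pi_Q _); apply: val_inj; rewrite /= rtrans_linear.
Qed.
Fact subquot_act1 x : subquot_act 1%g x = x.
Proof.
rewrite -[x in LHS]reprK -pi_sub_act -[RHS]reprK.
by congr (\pi_Q _); apply: val_inj; rewrite /= rtrans1.
Qed.
Fact subquot_actM g h x : subquot_act (g * h)%g x = subquot_act g (subquot_act h x).
Proof.
rewrite -[x]reprK -(pi_sub_act (g * h)) -(pi_sub_act h) -(pi_sub_act g).
by congr (\pi_Q _); apply: val_inj; rewrite /= rtransM.
Qed.

Definition subquot_gmod : gmod GL E :=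
  GMod subquot_act_linear subquot_act1 subquot_actM.

End SubQuotient.
End Induced.

Section Characters.
Variables (R : finComUnitRingType) (k E : fieldType).
Variables (red : {rmorphism R -> k}) (iota : {rmorphism k -> E}).
Implicit Type b : {'GL_2[R]}.

Definition det_pow (s : nat) b : E := iota (red (\det (GLval b))) ^+ s.
Definition chi_ (r : nat) b : E := iota (red (GLval b 1 1)) ^+ r.
Definition eta b : k := red (GLval b 0 0) / red (GLval b 1 1).

End Characters.

Definition exps (p f : nat) := {ffun 'I_f -> 'I_p}.
HB.instance Definition _ p f := Finite.on (exps p f).

Section Exps.
Variables (p f : nat) (pr_p : prime p).

Definition exps0 : exps p f := [ffun=> Ordinal (prime_gt0 pr_p)].
Definition exps_le (a b : exps p f) : bool := [forall i, (a i <= b i)%N].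
Definition exps_lt (a b : exps p f) : bool := exps_le a b && (a != b).
Definition wt (a : exps p f) : nat := (\sum_(i < f) a i * p ^ i)%N.

Definition zero_first n (j : {ffun 'I_n -> exps p f}) : {ffun 'I_n -> exps p f} :=
  [ffun i : 'I_n => if i == 0%N :> nat then exps0 else j i].
Definition last_le n (j : {ffun 'I_n -> exps p f}) (beta : exps p f) : bool :=
  [forall i : 'I_n, (i == n.-1 :> nat) ==> exps_le (j i) beta].

End Exps.

Section Filtration.
Variables (O : comNzRingType) (k : finFieldType) (E : fieldType).
Variables (R : finComUnitRingType) (pi : {rmorphism O -> R}).
Variables (red : {rmorphism R -> k}) (iota : {rmorphism k -> E}).
Variables (teich : k -> O) (varpi : O).
Variables (p f n : nat) (pr_p : prime p).
Local Notation GL := {'GL_2[R]}.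

(* The digits of l in its unique expansion \sum_i [l_i] varpi^i. *)
Definition digits (l : R) : {ffun 'I_n -> k} :=
  odflt [ffun=> 0]
    [pick d : {ffun 'I_n -> k} | l == pi (\sum_(i < n) teich (d i) * varpi ^+ i)].

Variables (s r : nat).

(* g (x) v : an element x equals b g^-1 precisely when b = x g. *)
Definition tens (g : GL) (v : E) : glfun R E :=
  [ffun x : GL => if (x * g)%g \in borel R then chi_ red iota r (x * g)%g * v else 0].

Definition f_ (j : {ffun 'I_n -> exps p f}) : glfun R E :=
  \sum_(l : R) tens (gl_lam l) (iota (\prod_(i < n) digits l i ^+ wt (j i))).

(* f_(oo, j_1, ..., j_(n-1)); the component j_0 is not used. *)
Definition f_oo (j : {ffun 'I_n -> exps p f}) : glfun R E :=
  rtrans (gl_w R) (f_ (zero_first pr_p j)).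

(* The identification of I_n(chi_r) with I_n(det^s chi_r). *)
Definition det_twist (phi : glfun R E) : glfun R E :=
  [ffun g => det_pow red iota s g * phi g].

Definition W_ (beta : exps p f) : {vspace glfun R E} :=
  << [seq det_twist (f_ j) | j in [set j | last_le j beta]] ++
     [seq det_twist (f_oo j) | j in [set j | last_le j beta]] >>%VS.

End Filtration.

(* Main.v *)
From HB Require Import structures.
Require Import Defs.
From mathcomp Require Import all_boot all_order all_algebra all_fingroup all_field.
From mathcomp Require Import ring.

(** Two points of the projective line over O/m^n with the same image over
    O/m^(n-1) differ by a lower unipotent matrix with entry e y = [y] varpi^(n-1);
    here e identifies k, additively, with the kernel of O/m^n -> O/m^(n-1).  So a
    function phi of the induced representation restricts on the fibre through g
    to the function y |-> phi (gl_low (e y) * g) on k, and as k has q = p^f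
    elements, this function is a unique linear combination of the monomials y^a,
    a in S.

    The subspace W_beta consists of the phi in whose fibre restrictions only
    monomials y^a with a <= beta occur ([last_exps_spanP], [W_last_exps_span]).
    This condition is imposed at all g at once, so right translations preserve
    it.  That the functions f_j satisfy it comes from two facts: along a fibre
    the last digit of the coordinate is an affine function of y, and in
    characteristic p the expansion of (z0 + y z1)^a only contains the y^b with
    b <= a ([coef_affine_monomial]).  Conversely a function satisfying the
    condition is interpolated by monomials in all n digits
    ([digit_interpolation]); the functions f_(oo, ...) first take care of the
    points outside of the affine chart, and the f_j of the rest.

    The isomorphism is induced by the map sending phi to the function
    g |-> coefficient of y^beta in the restriction of phi to the fibre through g.
    An element h of the preimage H of B(O/m^(n-1)) acts on the fibres by
    y |-> slope h + eta(h) y while multiplying the values by chi(h)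
    ([fibre_borel_preim]); the coefficient of the highest monomial is thus
    multiplied by chi(h) eta(h)^beta, and depends only on the image of g in
    GL_2(O/m^(n-1)) ([top_coef_borel_preim], [top_coef_map]).  Its vanishing
    means that only exponents a < beta occur, which describes the sum of the
    W_alpha ([top_coef_fun_eq0]).  Surjectivity comes from an explicit
    preimage: on a coset H x, put chi(h) slope(h)^beta psi(x) at h x
    ([spreadK]). *)

Set Implicit Arguments.
Unset Strict Implicit.
Unset Printing Implicit Defensive.

Import Order.TTheory GRing.Theory Num.Theory.
Local Open Scope ring_scope.

(** * Exponents in S and the base-p digits of their weights *)
Section Weights.
Variables (p f : nat) (pr_p : prime p).
Implicit Types a b : exps p f.

Lemma exps_le_refl a : exps_le a a.
Proof. by apply/forallP. Qed.

Lemma exps_le_trans a b c : exps_le a b -> exps_le b c -> exps_le a c.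
Proof.
by move=> /forallP ab /forallP bc; apply/forallP => i; apply: leq_trans (bc i).
Qed.

Lemma exps_le_anti a b : exps_le a b -> exps_le b a -> a = b.
Proof.
move=> /forallP ab /forallP ba; apply/ffunP => i; apply/val_inj/eqP.
by rewrite eqn_leq ab ba.
Qed.

Lemma exps_lt_le_trans a b c : exps_le a b -> exps_lt b c -> exps_lt a c.
Proof.
move=> ab /andP[bc nbc]; rewrite /exps_lt (exps_le_trans ab bc) /=.
by apply: contra nbc => /eqP ac; rewrite (exps_le_anti bc) // -ac.
Qed.

Lemma wt_exps0 : wt (exps0 f pr_p) = 0%N.
Proof. by rewrite /wt big1 // => i _; rewrite ffunE mul0n. Qed.

End Weights.

Lemma base_digits_lt p f (c : nat -> nat) :
  (0 < p)%N -> (forall i, (c i < p)%N) -> (\sum_(i < f) c i * p ^ i < p ^ f)%N.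
Proof.
move=> p0 cp; elim: f => [|f IHf]; first by rewrite big_ord0 expn0.
rewrite big_ord_recr /= expnS; apply: (@leq_trans ((c f).+1 * p ^ f)).
  by rewrite mulSn ltn_add2r.
by rewrite leq_mul2r cp orbT.
Qed.

Lemma base_digits_inj p f (c d : nat -> nat) :
  (0 < p)%N -> (forall i, (c i < p)%N) -> (forall i, (d i < p)%N) ->
  (\sum_(i < f) c i * p ^ i = \sum_(i < f) d i * p ^ i)%N ->
  forall i, (i < f)%N -> c i = d i.
Proof.
move=> p0 cp dp; elim: f => // f IHf; rewrite !big_ord_recr /= => e i.
have pf0 : (0 < p ^ f)%N by rewrite expn_gt0 p0.
have ef : c f = d f.
  have := congr1 (divn^~ (p ^ f)%N) e; rewrite /= !divnDMl //.
  by rewrite !divn_small ?base_digits_lt.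
rewrite ltnS leq_eqVlt => /predU1P[-> //|]; apply: IHf.
by move/eqP: e; rewrite ef eqn_add2r => /eqP.
Qed.

Section WeightBounds.
Variables (p f : nat) (pr_p : prime p).
Implicit Types a b : exps p f.

(* Padding with zeros outside 'I_f turns a into a sequence, to which the
   inductions on f above apply. *)
Let dig a (i : nat) : nat := oapp (fun j => a j : nat) 0%N (insub i : option 'I_f).

Let wt_dig a : wt a = (\sum_(i < f) dig a i * p ^ i)%N.
Proof. by apply: eq_bigr => i _; rewrite /dig valK. Qed.

Let dig_lt a i : (dig a i < p)%N.
Proof. by rewrite /dig; case: insubP => [j _ _ /=|_]; [exact: ltn_ord | exact: prime_gt0]. Qed.

Lemma wt_lt a : (wt a < p ^ f)%N.
Proof. by rewrite wt_dig base_digits_lt ?prime_gt0. Qed.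

Lemma wt_inj : injective (@wt p f).
Proof.
move=> a b; rewrite !wt_dig => /base_digits_inj e; apply/ffunP => i; apply: val_inj.
by have := e (prime_gt0 pr_p) (dig_lt a) (dig_lt b) i (ltn_ord i); rewrite /dig valK.
Qed.

End WeightBounds.

Lemma exprDn_widen (A : comPzRingType) (x y : A) m n : (m < n)%N ->
  (x + y) ^+ m = \sum_(j < n) (x ^+ (m - j) * y ^+ j) *+ 'C(m, j).
Proof.
move=> mn; rewrite exprDn.
rewrite (big_ord_widen n (fun j => (x ^+ (m - j) * y ^+ j) *+ 'C(m, j))) //.
rewrite big_mkcond; apply: eq_bigr => j _; rewrite ltnS; case: leqP => // mj.
by rewrite bin_small // mulr0n.
Qed.

(** * Functions on k as polynomials with exponents in S *)
Section Coefficients.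
Variables (p f : nat) (pr_p : prime p).
Variables (k : finFieldType) (card_k : #|k| = (p ^ f)%N).
Variables (E : fieldType) (iota : {rmorphism k -> E}).
Implicit Types (a b : exps p f) (h : k -> E) (D : pred (exps p f)).

Definition polyfun (c : {ffun exps p f -> E^o}) : {ffun k -> E^o} :=
  [ffun y => \sum_a c a * (iota y ^+ wt a)].

Fact polyfun_linear : linear polyfun.
Proof.
move=> l c d; apply/ffunP => y; rewrite !ffunE scaler_sumr -big_split /=.
by apply: eq_bigr => a _; rewrite !ffunE mulrDl /GRing.scale /= mulrA.
Qed.
HB.instance Definition _ := GRing.isLinear.Build E _ _ _ polyfun polyfun_linear.

(** The weights wt a are distinct and smaller than #|k|, so that a combination
    of monomials that vanishes on k is a polynomial with too many roots. *)
Fact polyfun_lker0 : lker (linfun polyfun) == 0%VS.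
Proof.
rewrite -subv0; apply/subvP => c; rewrite memv_ker lfunE /= => /eqP c0.
suff: c = 0 by move=> ->; rewrite mem0v.
pose P : {poly E} := \sum_a c a *: 'X^(wt a).
have P0 : P = 0.
  apply: (@roots_geq_poly_eq0 _ _ [seq iota y | y : k]).
  - apply/allP => _ /mapP[y _ ->]; rewrite rootE horner_sum.
    rewrite -[X in _ == X](_ : polyfun c y = 0).
      rewrite ffunE; apply/eqP; apply: eq_bigr => a _.
      by rewrite hornerZ hornerXn.
    by rewrite c0 ffunE.
  - by rewrite map_inj_uniq ?enum_uniq //; apply: fmorph_inj.
  rewrite size_map -cardE card_k; apply: (leq_trans (size_sum _ _ _)).
  apply/bigmax_leqP => a _; apply: leq_trans (size_scale_leq _ _) _.
  by rewrite size_polyXn wt_lt.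
apply/ffunP => a; rewrite ffunE.
have := congr1 (fun Q : {poly E} => Q`_(wt a)) P0; rewrite coef0 coef_sum => <-.
rewrite (bigD1 a) //= coefZ coefXn eqxx mulr1 big1 ?addr0 // => b nba.
by rewrite coefZ coefXn eq_sym (inj_eq (wt_inj pr_p)) (negbTE nba) mulr0.
Qed.

(** Monomials are independent ([polyfun_lker0]) and as many as the points of k,
    hence the evaluation map is invertible. *)
Definition coef h a : E := (linfun polyfun)^-1%VF [ffun y => h y] a.

Lemma polyfun_coef h y : h y = \sum_a coef h a * iota y ^+ wt a.
Proof.
have lim : limg (linfun polyfun) = fullv.
  apply/eqP; rewrite eqEdim subvf /= limg_dim_eq ?(eqP polyfun_lker0) ?capv0 //.
  by rewrite !dimvf /dim /= !muln1 card_k card_ffun !card_ord.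
have : [ffun y => h y] \in limg (linfun polyfun) by rewrite lim; exact: memvf.
move/limg_lfunVK; rewrite lfunE /= => /ffunP /(_ y).
by rewrite !ffunE => <-.
Qed.

Lemma coef_uniq h (c : exps p f -> E) :
  (forall y, h y = \sum_a c a * iota y ^+ wt a) -> coef h =1 c.
Proof.
move=> hc a; rewrite /coef.
have -> : [ffun y => h y] = linfun polyfun [ffun b => c b].
  apply/ffunP => y; rewrite lfunE /= !ffunE hc.
  by apply: eq_bigr => b _; rewrite ffunE.
by rewrite (lker0_lfunK polyfun_lker0) ffunE.
Qed.

Lemma eq_coef h g : h =1 g -> coef h =1 coef g.
Proof. by move=> hg; apply: coef_uniq => y; rewrite hg polyfun_coef. Qed.

Lemma coef_sum (I : finType) (l : I -> E) (g : I -> k -> E) a :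
  coef (fun y => \sum_i l i * g i y) a = \sum_i l i * coef (g i) a.
Proof.
apply: (@coef_uniq _ (fun a => \sum_i l i * coef (g i) a)) => y.
under eq_bigr => i _ do rewrite (polyfun_coef (g i)) mulr_sumr.
rewrite exchange_big; apply: eq_bigr => b _.
by rewrite mulr_suml; apply: eq_bigr => i _; rewrite mulrA.
Qed.

Lemma coef_lin l h g a :
  coef (fun y => l * h y + g y) a = l * coef h a + coef g a.
Proof.
apply: (@coef_uniq _ (fun a => l * coef h a + coef g a)) => y.
rewrite (polyfun_coef h) (polyfun_coef g) mulr_sumr -big_split.
by apply: eq_bigr => b _; rewrite mulrDl mulrA.
Qed.

Lemma coef_scale l h a : coef (fun y => l * h y) a = l * coef h a.
Proof.
apply: (@coef_uniq _ (fun a => l * coef h a)) => y.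
by rewrite (polyfun_coef h) mulr_sumr; apply: eq_bigr => b _; rewrite mulrA.
Qed.

Lemma coef_fun0 a : coef (fun=> 0) a = 0.
Proof. by rewrite (@coef_uniq _ (fun=> 0)) // => y; rewrite big1 // => b _; rewrite mul0r. Qed.

(** The coefficients of the Lagrange polynomial of the point y. *)
Definition delta_coef y a := coef (fun x => (x == y)%:R) a.

Lemma coef_delta h a : coef h a = \sum_y h y * delta_coef y a.
Proof.
rewrite -coef_sum; apply: eq_coef => x; rewrite (bigD1 x) //= eqxx mulr1.
by rewrite big1 ?addr0 // => y yx; rewrite eq_sym (negbTE yx) mulr0.
Qed.

Lemma polyfun_delta x y : \sum_a delta_coef y a * iota x ^+ wt a = (x == y)%:R.
Proof. by rewrite -polyfun_coef. Qed.

(** The coefficient of y^b in (z0 + y z1)^a, see [coef_affine_monomial]. *)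
Definition binom_coef (z0 z1 : k) a b : E :=
  \prod_(i < f) (((iota z0 ^+ (p ^ i)) ^+ (a i - b i) * (iota z1 ^+ (p ^ i)) ^+ b i)
            *+ 'C(a i, b i)).

(** As x |-> x ^ (p ^ i) is additive, (z0 + y z1)^a is the product over i of the
    (z0^(p^i) + y^(p^i) z1^(p^i))^(a_i); expanding the f binomials produces one
    monomial for each choice of exponents b_i < p, and the i-th binomial
    coefficient vanishes if b_i > a_i. *)
Lemma coef_affine_monomial z0 z1 a :
  coef (fun y => iota (z0 + y * z1) ^+ wt a) =1 binom_coef z0 z1 a.
Proof.
have pE : p \in [pchar E] by rewrite (fmorph_pchar iota) (card_finPcharP card_k).
apply: coef_uniq => y; rewrite rmorphD rmorphM expr_sum.
have step (i : 'I_f) : (iota z0 + iota y * iota z1) ^+ (a i * p ^ i) =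
    \sum_(j < p) (((iota z0 ^+ (p ^ i)) ^+ (a i - j) * (iota z1 ^+ (p ^ i)) ^+ j)
                   *+ 'C(a i, j)) * iota y ^+ (j * p ^ i).
  rewrite mulnC exprM exprDn_pchar; last first.
    by rewrite (eq_pnat _ (pcharf_eq pE)) pnatX pnat_id.
  rewrite exprMn (exprDn_widen _ _ (ltn_ord (a i))); apply: eq_bigr => j _.
  rewrite mulrnAl exprMn -mulrA; congr (_ * _ *+ _).
  by rewrite mulrC -!exprM (mulnC j).
under eq_bigr => i _ do rewrite step.
rewrite bigA_distr_bigA /=; apply: eq_bigr => b _.
by rewrite /binom_coef expr_sum -big_split.
Qed.

Lemma binom_coef_notle z0 z1 a b : ~~ exps_le b a -> binom_coef z0 z1 a b = 0.
Proof.
case/forallPn => i; rewrite -ltnNge => ab.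
by rewrite /binom_coef (bigD1 i) //= bin_small // mulr0n mul0r.
Qed.

Lemma binom_coef_diag z0 z1 a : binom_coef z0 z1 a a = iota z1 ^+ wt a.
Proof.
rewrite expr_sum; apply: eq_bigr => i _.
by rewrite subnn binn expr0 mul1r mulnC exprM.
Qed.

Definition down_closed D := forall a b, exps_le a b -> D b -> D a.
Definition exps_in D h := forall a, ~~ D a -> coef h a = 0.

Lemma coef_affine z0 z1 h b :
  coef (fun y => h (z0 + y * z1)) b = \sum_a coef h a * binom_coef z0 z1 a b.
Proof.
under eq_bigr => a _ do rewrite -coef_affine_monomial.
by rewrite -coef_sum; apply: eq_coef => y; rewrite (polyfun_coef h).
Qed.

Lemma exps_in_affine D z0 z1 h :
  down_closed D -> exps_in D h -> exps_in D (fun y => h (z0 + y * z1)).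
Proof.
move=> dD hD b nDb; rewrite coef_affine big1 // => a _.
have [Da|/hD ->] := boolP (D a); last by rewrite mul0r.
by rewrite binom_coef_notle ?mulr0 //; apply: contra nDb => /dD; apply.
Qed.

(** Among the a <= b, only a = b contributes to the coefficient of y^b after an
    affine substitution: the other monomials only produce exponents below a. *)
Lemma coef_affine_top z0 z1 h b :
  exps_in ((@exps_le p f)^~ b) h ->
  coef (fun y => h (z0 + y * z1)) b = iota z1 ^+ wt b * coef h b.
Proof.
move=> hb; rewrite coef_affine (bigD1 b) //= binom_coef_diag mulrC.
rewrite big1 ?addr0 // => a ab.
have [ltab|/hb ->] := boolP (exps_le a b); last by rewrite mul0r.
rewrite binom_coef_notle ?mulr0 //; apply: contra ab => ba.
by rewrite (exps_le_anti ba ltab).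
Qed.

Lemma exps_in_affine_monomial D z0 z1 a : down_closed D -> D a ->
  exps_in D (fun y => iota (z0 + y * z1) ^+ wt a).
Proof.
move=> dD Da b nDb; rewrite coef_affine_monomial binom_coef_notle //.
by apply: contra nDb => /dD; apply.
Qed.

End Coefficients.

(** * Two by two matrices *)
Section TwoByTwo.
Variable R : finComUnitRingType.
Implicit Types (g h : {'GL_2[R]}) (A B : 'M[R]_2).

Lemma mulmx2E A B i j : (A *m B) i j = A i 0 * B 0 j + A i 1 * B 1 j.
Proof.
by rewrite mxE !big_ord_recl big_ord0 addr0; congr (_ + A _ _ * B _ _); apply: val_inj.
Qed.

Lemma GLmulE g h i j :
  GLval (g * h)%g i j = GLval g i 0 * GLval h 0 j + GLval g i 1 * GLval h 1 j.
Proof. by rewrite -mulmx2E. Qed.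

Lemma GL1E i j : GLval (1%g : {'GL_2[R]}) i j = (i == j)%:R.
Proof. by rewrite mxE. Qed.

Lemma mx2_eqP A B : A 0 0 = B 0 0 -> A 0 1 = B 0 1 ->
  A 1 0 = B 1 0 -> A 1 1 = B 1 1 -> A = B.
Proof.
move=> e00 e01 e10 e11; apply/matrixP => i j.
have cases (l : 'I_2) : l = 0 \/ l = 1.
  by case: l => [[|[|//]] ?]; [left | right]; apply: val_inj.
by case: (cases i) (cases j) => -> [] ->.
Qed.

Lemma GL_eqP g h : GLval g 0 0 = GLval h 0 0 -> GLval g 0 1 = GLval h 0 1 ->
  GLval g 1 0 = GLval h 1 0 -> GLval g 1 1 = GLval h 1 1 -> g = h.
Proof. by move=> *; apply/val_inj/mx2_eqP. Qed.

Lemma det_mx22 A : \det A = A 0 0 * A 1 1 - A 0 1 * A 1 0.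
Proof.
rewrite (expand_det_row _ 0) !big_ord_recl big_ord0 addr0 /cofactor !det_mx11 !mxE.
rewrite /= expr0 expr1 mul1r mulN1r mulrN.
by congr (_ * A _ _ - A _ _ * A _ _); apply: val_inj.
Qed.

Lemma GLdetE g : \det (GLval g) =
  GLval g 0 0 * GLval g 1 1 - GLval g 0 1 * GLval g 1 0.
Proof. exact: det_mx22. Qed.

Lemma GLdetM g h : \det (GLval (g * h)%g) = \det (GLval g) * \det (GLval h).
Proof. by rewrite -det_mulmx. Qed.

Lemma GLdet_unit g : \det (GLval g) \is a GRing.unit.
Proof. by rewrite -unitmxE; exact: (valP g). Qed.

Lemma mx2_00 a b c d : mx2 a b c d 0 0 = a :> R. Proof. by rewrite mxE. Qed.
Lemma mx2_01 a b c d : mx2 a b c d 0 1 = b :> R. Proof. by rewrite mxE. Qed.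
Lemma mx2_10 a b c d : mx2 a b c d 1 0 = c :> R. Proof. by rewrite mxE. Qed.
Lemma mx2_11 a b c d : mx2 a b c d 1 1 = d :> R. Proof. by rewrite mxE. Qed.
Definition mx2E := (mx2_00, mx2_01, mx2_10, mx2_11).

Fact low_unit (t : R) : mx2 1 0 t 1 \is a GRing.unit.
Proof.
rewrite -[_ \is a GRing.unit]/(_ \in unitmx) unitmxE det_mx22 !mx2E.
by rewrite mul0r subr0 mulr1 unitr1.
Qed.
Definition gl_low (t : R) : {'GL_2[R]} := FinRing.Unit (low_unit t).

Lemma gl_low0 : gl_low 0 = 1%g.
Proof. by apply: GL_eqP; rewrite !GL1E !mx2E. Qed.

Lemma gl_lowD s t : gl_low (s + t) = (gl_low s * gl_low t)%g.
Proof.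
by apply: GL_eqP; rewrite !GLmulE !mx2E; rewrite ?(mulr0, mulr1, mul0r, mul1r, addr0, add0r).
Qed.

Lemma det_gl_low t : \det (GLval (gl_low t)) = 1.
Proof. by rewrite GLdetE !mx2E mul0r subr0 mulr1. Qed.

Fact inv_lam_unit (l : R) : mx2 0 1 1 (- l) \is a GRing.unit.
Proof.
rewrite -[_ \is a GRing.unit]/(_ \in unitmx) unitmxE det_mx22 !mx2E.
by rewrite mul0r sub0r mulr1 unitrN1.
Qed.

Lemma gl_lamV l : (gl_lam l)^-1%g = FinRing.Unit (inv_lam_unit l).
Proof.
apply/eqP; rewrite eq_invg_mul; apply/eqP.
by apply: GL_eqP; rewrite !GLmulE GL1E !mx2E ?(mulr0, mulr1, mul0r, mul1r, addr0, add0r, addrN).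
Qed.

Lemma gl_lamVE (l : R) : GLval (gl_lam l)^-1%g = mx2 0 1 1 (- l).
Proof. by rewrite gl_lamV. Qed.

Lemma gl_wK : (gl_w R * gl_w R)%g = 1%g.
Proof.
by apply: GL_eqP; rewrite !GLmulE GL1E !mx2E ?(mulr0, mulr1, mul0r, mul1r, addr0, add0r).
Qed.

(** Moving along a fibre translates the affine coordinate l of the projective
    line. *)
Lemma gl_low_lamV (s l : R) : (gl_low s * (gl_lam l)^-1 = (gl_lam (l - s))^-1)%g.
Proof.
apply: GL_eqP; rewrite !GLmulE !gl_lamVE !mx2E ?(mulr0, mulr1, mul0r, mul1r, addr0, add0r) //.
by rewrite opprB.
Qed.

Lemma borelP g : reflect (GLval g 1 0 = 0) (g \in borel R).
Proof. by rewrite inE; apply: eqP. Qed.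

End TwoByTwo.

(** * Small extensions and the preimage of the Borel subgroup *)

(** What the argument uses of O/m^n -> O/m^(n-1) -> k, where e is the
    bijection y |-> [y] varpi^(n-1) from k to the kernel of rho. *)
Record small_extension (R R' : finComUnitRingType) (k : finFieldType)
  (rho : {rmorphism R -> R'}) (red : {rmorphism R -> k}) (red' : {rmorphism R' -> k})
  (e : k -> R) : Prop := SmallExtension {
  small_red : forall x, red' (rho x) = red x;
  small_surj : forall x', exists x, rho x = x';
  small_unit : forall x, red x != 0 -> x \is a GRing.unit;
  small_add : {morph e : y z / y + z};
  small_mul : forall x y, x * e y = e (red x * y);
  small_ker : forall x, rho x = 0 <-> exists y, x = e y;
  small_inj : injective e
}.

Section SmallExtension.
Variables (R R' : finComUnitRingType) (k : finFieldType).
Variables (rho : {rmorphism R -> R'}) (red : {rmorphism R -> k}).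
Variables (red' : {rmorphism R' -> k}) (e : k -> R).
Hypothesis ext : small_extension rho red red' e.
Local Notation GL := {'GL_2[R]}.
Local Notation GL' := {'GL_2[R']}.
Implicit Types (g h b : GL) (y z : k).

Lemma small_rho0 y : rho (e y) = 0.
Proof. by apply/(small_ker ext); exists y. Qed.

Lemma small_red0 y : red (e y) = 0.
Proof. by rewrite -(small_red ext) small_rho0 rmorph0. Qed.

Lemma small_e0 : e 0 = 0.
Proof. by apply: (addrI (e 0)); rewrite -(small_add ext) !addr0. Qed.

Lemma small_opp : {morph e : y / - y}.
Proof. by move=> y; apply/eqP; rewrite -addr_eq0 -(small_add ext) addNr small_e0. Qed.

Lemma small_unitE x : (x \is a GRing.unit) = (red x != 0).
Proof.
apply/idP/idP; last exact: (small_unit ext).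
by rewrite -unitfE; apply: rmorph_unit.
Qed.

(** Any matrix of lifts of the entries is invertible, since units are detected
    on k. *)
Lemma gl_map_surj (g' : GL') : exists g, gl_map rho g = g'.
Proof.
have surj x : {y | rho y == x} by apply: sigW; have [y <-] := small_surj ext x; exists y.
pose A : 'M[R]_2 := \matrix_(i, j) sval (surj (GLval g' i j)).
have rA : map_mx rho A = GLval g'.
  by apply/matrixP => i j; rewrite !mxE; apply/eqP/(svalP (surj _)).
have uA : A \is a GRing.unit.
  rewrite -[_ \is a GRing.unit]/(_ \in unitmx) unitmxE small_unitE -(small_red ext).
  rewrite -det_map_mx rA -unitfE; apply: rmorph_unit; exact: GLdet_unit.
by exists (FinRing.Unit uA); apply: val_inj.
Qed.

Lemma gl_mapE g i j : GLval (gl_map rho g) i j = rho (GLval g i j).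
Proof. by rewrite mxE. Qed.

Definition borel_preim : {set GL} := [set g : GL | rho (GLval g 1 0) == 0].

Lemma borel_preimP g : reflect (exists y, GLval g 1 0 = e y) (g \in borel_preim).
Proof. by rewrite inE; apply: (iffP eqP) => /(small_ker ext). Qed.

Lemma mem_borel_preim g : (g \in borel_preim) = (gl_map rho g \in borel R').
Proof. by rewrite !inE gl_mapE. Qed.

Fact borel_preim_group_set : group_set borel_preim.
Proof.
apply/group_setP; split=> [|g h]; first by rewrite inE GL1E rmorph0.
rewrite !inE GLmulE rmorphD !rmorphM => /eqP-> /eqP->.
by rewrite mul0r mulr0 addr0.
Qed.
Canonical borel_preim_group := Group borel_preim_group_set.

Lemma borel_sub_preim : borel R \subset borel_preim.
Proof. by apply/subsetP => b /borelP b0; rewrite inE b0 rmorph0. Qed.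

Lemma low_borel_preim y : gl_low (e y) \in borel_preim.
Proof. by rewrite inE mx2E small_rho0. Qed.

Lemma red_borel_preim10 h : h \in borel_preim -> red (GLval h 1 0) = 0.
Proof. by move=> /borel_preimP[y ->]; apply: small_red0. Qed.

Lemma red_borel_preim11 h : h \in borel_preim -> red (GLval h 1 1) != 0.
Proof.
move=> hH; have := GLdet_unit h; rewrite small_unitE GLdetE rmorphB !rmorphM.
by rewrite red_borel_preim10 // mulr0 subr0 mulf_eq0 => /norP[].
Qed.

(** The y such that h is an element of the Borel subgroup times gl_low (e y);
    it exists, and is unique, when h is in [borel_preim]. *)
Definition slope h : k := odflt 0 [pick y | GLval h 1 0 == GLval h 1 1 * e y].

Lemma slope_eq h y :
  h \in borel_preim -> GLval h 1 0 = GLval h 1 1 * e y -> slope h = y.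
Proof.
move=> /red_borel_preim11 u hy; rewrite /slope; case: pickP => [z /eqP|/(_ y)]; last first.
  by rewrite hy eqxx.
by rewrite hy !(small_mul ext) => /(small_inj ext) /(mulfI u).
Qed.

Lemma slopeE h : h \in borel_preim -> GLval h 1 0 = GLval h 1 1 * e (slope h).
Proof.
move=> hH; have [y hy] := borel_preimP _ hH.
have hz : GLval h 1 0 = GLval h 1 1 * e (y / red (GLval h 1 1)).
  by rewrite (small_mul ext) mulrCA divff ?mulr1 // red_borel_preim11.
by rewrite {1}hz (slope_eq hH hz).
Qed.

Lemma slope_borel b h : b \in borel R -> h \in borel_preim -> slope (b * h)%g = slope h.
Proof.
move=> bB hH; apply: slope_eq; first by rewrite groupM // (subsetP borel_sub_preim).
by rewrite !GLmulE (borelP _ bB) !mul0r !add0r -mulrA -slopeE.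
Qed.

Lemma slope_low y h : h \in borel_preim ->
  slope (gl_low (e y) * h)%g = slope h + y * eta red h.
Proof.
move=> hH; apply: slope_eq; first by rewrite groupM ?low_borel_preim.
rewrite !GLmulE !mx2E !mul1r (small_mul ext) rmorphD rmorphM small_red0 mul0r add0r.
rewrite slopeE // [e y * _]mulrC !(small_mul ext) -(small_add ext) mulrDr addrC.
congr (e (_ + _)); rewrite mulrCA mulrC; congr (_ * _).
by rewrite /eta mulrC divfK ?red_borel_preim11.
Qed.

Section Character.
Variables (E : fieldType) (iota : {rmorphism k -> E}) (s r : nat).

(** The character chi, extended to the whole group by its formula: it is
    multiplicative on [borel_preim], where the lower left entry vanishes in k. *)
Definition borel_char g : E := det_pow red iota s g * chi_ red iota r g.

Lemma borel_charM g h : g \in borel_preim -> borel_char (g * h)%g = borel_char g * borel_char h.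
Proof.
move=> gH; rewrite /borel_char /det_pow /chi_ GLdetM GLmulE rmorphD !rmorphM.
by rewrite red_borel_preim10 // mul0r add0r !rmorphM !exprMn mulrACA.
Qed.

Lemma borel_char_low y h : borel_char (gl_low (e y) * h)%g = borel_char h.
Proof.
rewrite borel_charM ?low_borel_preim // /borel_char /det_pow /chi_ det_gl_low mx2E.
by rewrite !rmorph1 !expr1n !mul1r.
Qed.

Lemma borel_decomposition h : h \in borel_preim ->
  exists2 b, b \in borel R & borel_char b = borel_char h /\ h = (b * gl_low (e (slope h)))%g.
Proof.
move=> hH; set t := e (slope h).
have hE : h = (h * gl_low (- t) * gl_low t)%g.
  by rewrite -mulgA -gl_lowD addNr gl_low0 mulg1.
exists (h * gl_low (- t))%g; last split=> //.
  by apply/borelP; rewrite GLmulE !mx2E mulr1 slopeE // mulrN subrr.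
rewrite borel_charM // -[in RHS](mulr1 (borel_char h)); congr (_ * _).
by rewrite /borel_char /det_pow /chi_ det_gl_low mx2E !rmorph1 !expr1n mulr1.
Qed.

End Character.

End SmallExtension.

(** * Restriction to fibres and the coefficient of the highest monomial *)
Section Fibres.
Variables (p f : nat) (pr_p : prime p).
Variables (R R' : finComUnitRingType) (k : finFieldType) (card_k : #|k| = (p ^ f)%N).
Variables (rho : {rmorphism R -> R'}) (red : {rmorphism R -> k}).
Variables (red' : {rmorphism R' -> k}) (e : k -> R).
Hypothesis ext : small_extension rho red red' e.
Variables (E : fieldType) (iota : {rmorphism k -> E}) (s r : nat).
Variable chi : {'GL_2[R]} -> E.
Hypothesis chiE : {in borel R, forall b, chi b = borel_char red iota s r b}.
Implicit Types (g h b : {'GL_2[R]}) (phi : glfun R E) (D : pred (exps p f)) (beta : exps p f).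

Definition fibre phi g (y : k) : E := phi (gl_low (e y) * g)%g.

Definition fibrewise D phi :=
  phi \in in_ind chi /\ forall g, exps_in iota D (fibre phi g).

Lemma fibrewise_sub D D' phi : subpred D D' -> fibrewise D phi -> fibrewise D' phi.
Proof.
by move=> DD' [hi hf]; split=> // g a nD; apply: hf; apply: contra nD; apply: DD'.
Qed.

Lemma coef_fibre_rtrans g phi h (a : exps p f) :
  coef iota (fibre (rtrans g phi) h) a = coef iota (fibre phi (h * g)%g) a.
Proof.
by apply: (eq_coef pr_p card_k) => y; rewrite /fibre ffunE mulgA.
Qed.

(** The condition bears on all g, and translation by g permutes the fibres. *)
Lemma fibrewise_stable D g phi : fibrewise D phi -> fibrewise D (rtrans g phi).
Proof.
move=> [hi hf]; split=> [|h a nDa]; first exact: (ind_act_subproof g (Ind hi)).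
by rewrite coef_fibre_rtrans hf.
Qed.

Lemma coef_fibre_lin l phi psi g (a : exps p f) :
  coef iota (fibre (l *: phi + psi) g) a =
  l * coef iota (fibre phi g) a + coef iota (fibre psi g) a.
Proof.
rewrite -(coef_lin pr_p card_k); apply: (eq_coef pr_p card_k) => y.
by rewrite /fibre !ffunE.
Qed.

Lemma fibrewise0 D : fibrewise D 0.
Proof.
split=> [|g a _]; first by apply/in_indP => c h _; rewrite !ffunE mulr0.
rewrite -[RHS](coef_fun0 pr_p card_k iota a); apply: (eq_coef pr_p card_k) => y.
by rewrite /fibre ffunE.
Qed.

Lemma fibrewise_lin D l phi psi :
  fibrewise D phi -> fibrewise D psi -> fibrewise D (l *: phi + psi).
Proof.
move=> [i1 f1] [i2 f2]; split=> [|g a nDa].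
  by apply/in_indP => b g Bb; rewrite !ffunE (in_indP _ _ i1) // (in_indP _ _ i2) //
    /GRing.scale /= mulrDr mulrCA.
by rewrite coef_fibre_lin f1 // f2 // mulr0 addr0.
Qed.

Lemma fibrewise_span D (X : seq (glfun R E)) phi :
  (forall x, x \in X -> fibrewise D x) -> phi \in <<X>>%VS -> fibrewise D phi.
Proof.
move=> hX /(@coord_span _ _ _ (in_tuple X)) ->.
elim/big_rec: _ => [|i x _ hx]; first exact: fibrewise0.
by apply: fibrewise_lin => //; apply: hX; apply: mem_nth.
Qed.

(** The product gl_low (e y) * h is again in the preimage of the Borel subgroup:
    writing it as a Borel element times a unipotent one permits to use the
    equivariance of phi. *)
Lemma fibre_borel_preim phi h g y : phi \in in_ind chi -> h \in borel_preim rho ->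
  fibre phi (h * g)%g y = borel_char red iota s r h * fibre phi g (slope e h + y * eta red h).
Proof.
move=> /in_indP hi hH; have nH : (gl_low (e y) * h)%g \in borel_preim rho.
  by rewrite groupM ?(low_borel_preim ext).
have [b bB [bc bE]] := borel_decomposition ext iota s r nH.
rewrite /fibre mulgA bE -mulgA (hi b _ bB) chiE // bc (borel_char_low ext) //.
by rewrite (slope_low ext).
Qed.

Definition top_coef (beta : exps p f) phi g : E := coef iota (fibre phi g) beta.

Definition below (beta a : exps p f) : bool := exps_le a beta.

Definition borel_char_eta (beta : exps p f) (g : {'GL_2[R']}) : E :=
  det_pow red' iota s g * chi_ red' iota r g * iota (eta red' g ^+ wt beta).

Lemma borel_char_eta_map beta h :
  borel_char_eta beta (gl_map rho h) = borel_char red iota s r h * iota (eta red h) ^+ wt beta.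
Proof.
rewrite /borel_char_eta /borel_char /det_pow /chi_ /eta !gl_mapE !GLdetE !gl_mapE.
by rewrite !rmorphXn !rmorphB !rmorphM !(small_red ext).
Qed.

Lemma top_coef_borel_preim beta phi h g : fibrewise (below beta) phi -> h \in borel_preim rho ->
  top_coef beta phi (h * g)%g = borel_char_eta beta (gl_map rho h) * top_coef beta phi g.
Proof.
move=> [hi hf] hH; rewrite /top_coef.
rewrite (eq_coef pr_p card_k _ (fun y => fibre_borel_preim g y hi hH)).
rewrite (coef_scale pr_p card_k) (coef_affine_top pr_p card_k _ _ (hf g)).
by rewrite borel_char_eta_map mulrA.
Qed.

Definition gl_lift (g' : {'GL_2[R']}) : {'GL_2[R]} :=
  odflt 1%g [pick g | gl_map rho g == g'].

Lemma gl_liftK (g' : {'GL_2[R']}) : gl_map rho (gl_lift g') = g'.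
Proof.
rewrite /gl_lift; case: pickP => [g /eqP //|none].
by have [g hg] := gl_map_surj ext g'; have := none g; rewrite hg eqxx.
Qed.

(** Two elements with the same image differ by an h that is the identity modulo
    the kernel of rho, for which [top_coef_borel_preim] has factor 1. *)
Lemma top_coef_map beta phi g h : fibrewise (below beta) phi -> gl_map rho g = gl_map rho h ->
  top_coef beta phi g = top_coef beta phi h.
Proof.
move=> hf gh; have hE : gl_map rho (g * h^-1)%g = 1%g.
  apply: (mulIg (gl_map rho h)); by rewrite -gl_mapM mulgKV mul1g.
rewrite -[g](mulgKV h) top_coef_borel_preim ?mem_borel_preim ?hE; last by rewrite inE GL1E.
  rewrite -{1}(gl_map1 rho) borel_char_eta_map /borel_char /det_pow /chi_ /eta GLdetE !GL1E.
  by rewrite mulr1 mulr0 subr0 !rmorph1 divr1 rmorph1 !expr1n !mul1r.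
by [].
Qed.

(** The choice of a lift is immaterial by [top_coef_map]. *)
Definition top_coef_fun beta phi : glfun R' E := [ffun g' => top_coef beta phi (gl_lift g')].

Lemma top_coef_funE beta phi g : fibrewise (below beta) phi ->
  top_coef_fun beta phi (gl_map rho g) = top_coef beta phi g.
Proof. by move=> hf; rewrite ffunE; apply: top_coef_map => //; rewrite gl_liftK. Qed.

Lemma top_coef_fun_ind beta phi : fibrewise (below beta) phi ->
  top_coef_fun beta phi \in in_ind (borel_char_eta beta).
Proof.
move=> hf; apply/in_indP => b' g' bB.
rewrite -(gl_liftK b') -(gl_liftK g') -gl_mapM !top_coef_funE // top_coef_borel_preim //.
by rewrite mem_borel_preim gl_liftK.
Qed.

Lemma top_coef_fun_stable beta phi g : fibrewise (below beta) phi ->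
  top_coef_fun beta (rtrans g phi) = rtrans (gl_map rho g) (top_coef_fun beta phi).
Proof.
move=> hf; apply/ffunP => x'; rewrite -(gl_liftK x').
rewrite top_coef_funE; last exact: fibrewise_stable.
rewrite [RHS]ffunE -gl_mapM top_coef_funE //; exact: coef_fibre_rtrans.
Qed.

Lemma top_coef_fun_lin beta l phi psi :
  top_coef_fun beta (l *: phi + psi) = l *: top_coef_fun beta phi + top_coef_fun beta psi.
Proof. by apply/ffunP => x; rewrite !ffunE /top_coef coef_fibre_lin. Qed.

Lemma top_coef_fun_eq0 beta phi : fibrewise (below beta) phi ->
  top_coef_fun beta phi = 0 <-> fibrewise (fun a => exps_lt a beta) phi.
Proof.
move=> hf; split=> [h0|[_ hlt]].
  split=> [|g a]; first exact: hf.1.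
  rewrite /exps_lt negb_and negbK => /orP[/(hf.2 g)//|/eqP->].
  by rewrite -/(top_coef _ _ _) -top_coef_funE // h0 ffunE.
apply/ffunP => x'; rewrite -(gl_liftK x') top_coef_funE // ffunE; apply: hlt.
by rewrite /exps_lt eqxx andbF.
Qed.

(** A transversal of the cosets of [borel_preim], that is, of the fibres. *)
Definition preim_repr g := repr (borel_preim_group rho :* g)%g.

(** The preimage of psi under the coefficient map that restricts to a multiple
    of y^beta on the fibre through each element of the transversal. *)
Definition spread beta (psi : glfun R' E) : glfun R E := [ffun g =>
  let h := (g * (preim_repr g)^-1)%g in
  borel_char red iota s r h * iota (slope e h) ^+ wt beta * psi (gl_map rho (preim_repr g))].

Lemma preim_repr_coset g : (g * (preim_repr g)^-1)%g \in borel_preim rho.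
Proof. by rewrite -mem_rcoset rcoset_sym mem_repr_rcoset. Qed.

Lemma preim_repr_mul h g : h \in borel_preim rho -> preim_repr (h * g)%g = preim_repr g.
Proof. by move=> hH; rewrite /preim_repr rcosetM rcoset_id. Qed.

Lemma spread_mul beta psi h g : h \in borel_preim rho ->
  spread beta psi (h * g)%g = borel_char red iota s r (h * (g * (preim_repr g)^-1))%g *
    iota (slope e (h * (g * (preim_repr g)^-1))%g) ^+ wt beta * psi (gl_map rho (preim_repr g)).
Proof. by move=> hH; rewrite ffunE preim_repr_mul // mulgA. Qed.

Lemma fibre_spread beta psi g y : fibre (spread beta psi) g y =
  let h := (g * (preim_repr g)^-1)%g in
  borel_char red iota s r h * psi (gl_map rho (preim_repr g)) *
  iota (slope e h + y * eta red h) ^+ wt beta.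
Proof.
rewrite /fibre spread_mul ?(low_borel_preim ext) // (borel_char_low ext).
by rewrite (slope_low ext) ?preim_repr_coset // mulrAC.
Qed.

Lemma spread_fibrewise beta psi : fibrewise (below beta) (spread beta psi).
Proof.
split=> [|g a nle].
  apply/in_indP => c g cB; have cI := subsetP (borel_sub_preim rho) _ cB.
  rewrite spread_mul // (borel_charM ext) // (slope_borel ext) ?preim_repr_coset //.
  by rewrite ffunE chiE // !mulrA.
rewrite (eq_coef pr_p card_k _ (fibre_spread beta psi g)) (coef_scale pr_p card_k).
by rewrite (coef_affine_monomial pr_p card_k) binom_coef_notle ?mulr0.
Qed.

Lemma spreadK beta psi : psi \in in_ind (borel_char_eta beta) ->
  top_coef_fun beta (spread beta psi) = psi.
Proof.
move=> /in_indP hpsi; apply/ffunP => x'; rewrite -(gl_liftK x'); set g := gl_lift x'.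
rewrite top_coef_funE; last exact: spread_fibrewise.
rewrite /top_coef (eq_coef pr_p card_k _ (fibre_spread beta psi g)) (coef_scale pr_p card_k).
rewrite (coef_affine_monomial pr_p card_k) binom_coef_diag mulrAC -borel_char_eta_map.
by rewrite -hpsi -?mem_borel_preim ?preim_repr_coset // -gl_mapM mulgKV.
Qed.

End Fibres.

(** * Interpolation in several digits *)
Section MultiInterpolation.
Variables (p f : nat) (pr_p : prime p).
Variables (k : finFieldType) (card_k : #|k| = (p ^ f)%N).
Variables (E : fieldType) (iota : {rmorphism k -> E}) (n : nat).
Local Notation digs := {ffun 'I_n -> k}.
Local Notation mexps := {ffun 'I_n -> exps p f}.
Implicit Types (d : digs) (j : mexps) (F : digs -> E).

Definition set_dig d (i : 'I_n) (y : k) : digs :=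
  [ffun i' => if i' == i then y else d i'].

Definition digit_monomial d j : E := \prod_i iota (d i) ^+ wt (j i).

(** The tensor power of the interpolation formula [coef_delta]. *)
Definition digit_coef F j : E := \sum_d F d * \prod_i delta_coef iota (d i) (j i).

Lemma digit_interpolation F d : F d = \sum_j digit_coef F j * digit_monomial d j.
Proof.
under eq_bigr => j _ do rewrite mulr_suml.
rewrite exchange_big (bigD1 d) //=.
have E1 (d' : digs) :
    \sum_(j : mexps) F d' * (\prod_i delta_coef iota (d' i) (j i)) * digit_monomial d j =
    F d' * (d == d')%:R.
  under eq_bigr => j _ do rewrite -mulrA -big_split /=.
  rewrite -mulr_sumr.
  rewrite -(bigA_distr_bigA (fun i a => delta_coef iota (d' i) a * iota (d i) ^+ wt a)).
  congr (_ * _); under eq_bigr => i _ do rewrite (polyfun_delta pr_p card_k).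
  have [->|dd'] := eqVneq d d'; first by rewrite big1 // => i _; rewrite eqxx.
  have [i di] : exists i, d i != d' i.
    apply/existsP; rewrite -negb_forall; apply: contra dd' => /forallP h.
    by apply/eqP/ffunP => i; apply/eqP.
  by rewrite (bigD1 i) //= (negbTE di) mul0r.
rewrite E1 eqxx mulr1 big1 ?addr0 // => d' d'd.
by rewrite E1 eq_sym (negbTE d'd) mulr0.
Qed.

(** Summing over the i-th digit first, with the other digits fixed, makes
    a coefficient of a restriction of F appear. *)
Lemma digit_coef_eq0 F (D : pred (exps p f)) (i : 'I_n) j :
  (forall d, exps_in iota D (fun y => F (set_dig d i y))) -> ~~ D (j i) -> digit_coef F j = 0.
Proof.
(* Digit vectors that agree off i form a class, indexed by its member with i-th
   digit 0. *)
move=> hF nD; rewrite /digit_coef (partition_big (fun d => set_dig d i 0) predT) //=.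
apply: big1 => d0 _.
have [d0i|d0i] := eqVneq (d0 i) 0; last first.
  by rewrite big1 // => d /eqP de; case/eqP: d0i; rewrite -de ffunE eqxx.
rewrite (reindex_onto (set_dig d0 i) (fun d => d i)) /=; last first.
  move=> d /eqP <-; apply/ffunP => i'; rewrite !ffunE; by case: eqP => // ->.
rewrite (eq_bigl predT); last first.
  move=> y; rewrite !ffunE eqxx eqxx andbT; apply/eqP/ffunP => i'.
  by rewrite !ffunE; case: eqP => // ->.
under eq_bigr => y _ do rewrite (bigD1 i) //= ffunE eqxx.
transitivity ((\prod_(i' | i' != i) delta_coef iota (d0 i') (j i')) *
   coef iota (fun y => F (set_dig d0 i y)) (j i)).
  rewrite (coef_delta pr_p card_k) mulr_sumr; apply: eq_bigr => y _.
  rewrite [RHS]mulrC mulrA; congr (_ * _); apply: eq_bigr => i' ni.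
  by rewrite ffunE (negbTE ni).
by rewrite hF ?mulr0.
Qed.

End MultiInterpolation.

(** * The functions f_j span the functions with bounded fibre exponents *)
Section Generators.
Variables (p f : nat) (pr_p : prime p).
Variables (O : comNzRingType) (R R' : finComUnitRingType) (k : finFieldType).
Variable card_k : #|k| = (p ^ f)%N.
Variables (rho : {rmorphism R -> R'}) (red : {rmorphism R -> k}).
Variables (red' : {rmorphism R' -> k}) (e : k -> R).
Hypothesis ext : small_extension rho red red' e.
Variables (E : fieldType) (iota : {rmorphism k -> E}) (s r : nat).
Variable chi : {'GL_2[R]} -> E.
Hypothesis chiE : {in borel R, forall b, chi b = borel_char red iota s r b}.
Variables (pi : {rmorphism O -> R}) (teich : k -> O) (varpi : O) (n : nat).
Local Notation digs := {ffun 'I_n -> k}.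
Local Notation mexps := {ffun 'I_n -> exps p f}.
Local Notation dig := (digits pi teich varpi n).
Variables (i0 il : 'I_n) (undig : digs -> R).
Hypotheses (i0E : i0 = 0%N :> nat) (ilE : il = n.-1 :> nat) (i0l : i0 != il).
Hypotheses (digK : cancel dig undig) (undigK : cancel undig dig).
Hypothesis undig_last : forall d y, undig (set_dig d il y) = undig d + e (y - d il).
Hypothesis red_undig : forall d, red (undig d) = d i0.
Implicit Types (g h b : {'GL_2[R]}) (phi : glfun R E) (D : pred (exps p f)).
Implicit Types (d : digs) (j : mexps) (beta : exps p f).

Local Notation fj := (@f_ O k E R pi red iota teich varpi p f n r).
Local Notation fooj := (@f_oo O k E R pi red iota teich varpi p f n pr_p r).
Local Notation twist := (@det_twist k E R red iota s).
Definition twisted_f j : glfun R E := twist (fj j).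

Lemma dig_add_last l y : dig (l + e y) = set_dig (dig l) il (dig l il + y).
Proof. by apply: (can_inj undigK); rewrite undig_last !digK addrAC subrr add0r. Qed.

Lemma gl_lam_borel g l :
  ((g * gl_lam l)%g \in borel R) = (GLval g 1 0 * l + GLval g 1 1 == 0).
Proof. by rewrite inE GLmulE !mx2E mulr1. Qed.

Lemma unit_bottom_row g : red (GLval g 1 0) = 0 -> red (GLval g 1 1) != 0.
Proof.
move=> g0; have := GLdet_unit g; rewrite (small_unitE ext) GLdetE rmorphB !rmorphM.
by rewrite g0 mulr0 subr0 mulf_eq0 => /norP[].
Qed.

(** The l for which g lies in the coset of the Borel subgroup that contains the
    inverse of gl_lam l; such an l exists when the lower left entry of g is a
    unit. *)
Definition affine_coord g : R := - (GLval g 1 1 / GLval g 1 0).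

Lemma f_infinity j g : red (GLval g 1 0) = 0 -> fj j g = 0.
Proof.
move=> g0; rewrite /f_ sum_ffunE big1 // => l _; rewrite ffunE gl_lam_borel.
case: eqP => // /(congr1 red); rewrite rmorphD rmorphM g0 mul0r add0r rmorph0.
by move/eqP; rewrite (negbTE (unit_bottom_row g0)).
Qed.

Lemma f_affine j g : red (GLval g 1 0) != 0 ->
  fj j g = iota (red (GLval g 1 0)) ^+ r * digit_monomial iota (dig (affine_coord g)) j.
Proof.
move=> g0; have u : GLval g 1 0 \is a GRing.unit by rewrite (small_unitE ext).
rewrite /f_ sum_ffunE (bigD1 (affine_coord g)) //= [X in _ + X]big1 ?addr0 => [|l ll].
  rewrite ffunE gl_lam_borel /affine_coord mulrN mulrCA divrr // mulr1 addNr eqxx.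
  rewrite /chi_ GLmulE !mx2E mulr1 mulr0 addr0; congr (_ * _).
  by rewrite rmorph_prod; apply: eq_bigr => i _; rewrite rmorphXn.
rewrite ffunE gl_lam_borel; case: eqP => // /eqP; rewrite addr_eq0 => /eqP h.
case/eqP: ll; rewrite /affine_coord -mulNr -h; apply/esym; rewrite mulrC mulKr //.
Qed.

Lemma twistE phi g : twist phi g = det_pow red iota s g * phi g.
Proof. by rewrite ffunE. Qed.

Lemma det_powM g h : det_pow red iota s (g * h)%g = det_pow red iota s g * det_pow red iota s h.
Proof. by rewrite /det_pow GLdetM !rmorphM exprMn. Qed.

Lemma twisted_f_ind j : twisted_f j \in in_ind chi.
Proof.
apply/in_indP => b g bB; rewrite !twistE det_powM chiE // /borel_char /chi_.
have b11 : red (GLval b 1 1) != 0.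
  by apply: unit_bottom_row; rewrite (borelP _ bB) rmorph0.
have E10 : GLval (b * g)%g 1 0 = GLval b 1 1 * GLval g 1 0.
  by rewrite GLmulE (borelP _ bB) mul0r add0r.
have E11 : GLval (b * g)%g 1 1 = GLval b 1 1 * GLval g 1 1.
  by rewrite GLmulE (borelP _ bB) mul0r add0r.
have [g0|g0] := eqVneq (red (GLval g 1 0)) 0.
  by rewrite !f_infinity ?mulr0 // E10 rmorphM g0 mulr0.
rewrite !f_affine // ?E10 ?rmorphM ?mulf_neq0 // /affine_coord E10 E11.
have -> : GLval b 1 1 * GLval g 1 1 / (GLval b 1 1 * GLval g 1 0) = GLval g 1 1 / GLval g 1 0.
  rewrite invrM ?(small_unitE ext) // [(GLval g 1 0)^-1 * _]mulrC mulrACA.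
  by rewrite divrr ?mul1r ?(small_unitE ext).
rewrite ?rmorphM exprMn -!mulrA; congr (_ * _).
by rewrite mulrCA; congr (_ * _); exact: mulrCA.
Qed.

(** Along a fibre the bottom row stays the same in k, and the affine coordinate
    changes by e (y z) for a constant z, hence only its last digit changes, and
    it does so affinely. *)
Lemma twisted_f_fibrewise D j : down_closed D -> D (j il) ->
  fibrewise e iota chi D (twisted_f j).
Proof.
move=> dD Dj; split=> [|g a nDa]; first exact: twisted_f_ind.
set c := GLval g 1 0; set dd := GLval g 1 1.
have [g0|g0] := eqVneq (red c) 0.
  rewrite (@eq_coef _ _ pr_p _ card_k _ iota _ (fun=> 0)) ?(coef_fun0 pr_p card_k) // => y.
  rewrite /fibre twistE f_infinity ?mulr0 // GLmulE !mx2E mul1r rmorphD rmorphM.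
  by rewrite (small_red0 ext) mul0r add0r.
have u : c \is a GRing.unit by rewrite (small_unitE ext).
(* z comes from the variation of -d / c along the fibre, where (c, d) is the
   bottom row. *)
pose z := - ((red (GLval g 0 1) - red (GLval g 0 0) * (red dd / red c)) / red c).
pose l := affine_coord g.
rewrite (@eq_coef _ _ pr_p _ card_k _ iota _ (fun y =>
    (det_pow red iota s g * (iota (red c) ^+ r *
      \prod_(i | i != il) iota (dig l i) ^+ wt (j i))) *
    iota (dig l il + y * z) ^+ wt (j il))).
  rewrite (coef_scale pr_p card_k).
  by rewrite (exps_in_affine_monomial pr_p card_k _ _ _ dD Dj) ?mulr0.
move=> y; rewrite /fibre twistE det_powM {1}/det_pow det_gl_low !rmorph1 expr1n mul1r -!mulrA.
congr (_ * _).
have E10 : red (GLval (gl_low (e y) * g)%g 1 0) = red c.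
  by rewrite GLmulE !mx2E mul1r rmorphD rmorphM (small_red0 ext) mul0r add0r.
rewrite f_affine ?E10 //; congr (_ * _).
have -> : affine_coord (gl_low (e y) * g)%g = l + e (y * z).
  have uc : GLval (gl_low (e y) * g)%g 1 0 \is a GRing.unit by rewrite (small_unitE ext) E10.
  have lc : l * c = - dd by rewrite /l /affine_coord mulNr divrK.
  have rl : red l = - (red dd / red c).
    by rewrite /l /affine_coord rmorphN rmorphM rmorphV.
  apply: (mulIr uc); rewrite {1}/affine_coord mulNr divrK // !GLmulE !mx2E !mul1r.
  rewrite !(mulrC (e y)) -/c -/dd mulrDl mulrDr lc [e (y * z) * _]mulrC !(small_mul ext).
  rewrite rmorphD (small_red0 ext) add0r addrAC -(small_add ext) opprD; congr (_ - _).
  by rewrite -(small_opp ext); congr e; rewrite rl /z; field.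
rewrite dig_add_last /digit_monomial (bigD1 il) //= mulrC !ffunE eqxx; congr (_ * _).
by apply: eq_bigr => i ni; rewrite ffunE (negbTE ni).
Qed.

(** W_beta for a general condition D on the last exponent, so as to treat the
    condition a < beta as well. *)
Definition last_exps_span D : {vspace glfun R E} :=
  << [seq twisted_f j | j in [set j : mexps | D (j il)]] ++
     [seq twist (fooj j) | j in [set j : mexps | D (j il)]] >>%VS.

Lemma W_last_exps_span beta :
  @W_ O k E R pi red iota teich varpi p f n pr_p s r beta = last_exps_span (below beta).
Proof.
rewrite /W_ /last_exps_span.
have -> : [set j : mexps | last_le j beta] = [set j : mexps | below beta (j il)].
  apply/setP => j; rewrite !inE /last_le /below; apply/forallP/idP => [/(_ il)|h i].
    by rewrite ilE eqxx.
  by apply/implyP => /eqP ii; rewrite (_ : i = il) //; apply: ord_inj; rewrite ii ilE.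
by [].
Qed.

Lemma det_pow_neq0 g : det_pow red iota s g != 0.
Proof.
rewrite /det_pow expf_neq0 // fmorph_eq0 -(small_unitE ext); exact: GLdet_unit.
Qed.

Lemma twist_foo j :
  twist (fooj j) = (det_pow red iota s (gl_w R))^-1 *:
    rtrans (gl_w R) (twisted_f (zero_first pr_p j)).
Proof.
apply/ffunP => g; rewrite !ffunE det_powM /GRing.scale /= mulrA.
by rewrite [_ * det_pow _ _ _ (gl_w R)]mulrC mulKf ?det_pow_neq0.
Qed.

Lemma zero_first_last j : zero_first pr_p j il = j il.
Proof. by rewrite ffunE -i0E (inj_eq val_inj) eq_sym (negbTE i0l). Qed.

Lemma zero_first_id j : j i0 = exps0 f pr_p -> zero_first pr_p j = j.
Proof.
move=> j0; apply/ffunP => i; rewrite ffunE; case: eqP => // i00.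
by rewrite (_ : i = i0) ?j0 //; apply: ord_inj; rewrite i00 i0E.
Qed.

Lemma last_exps_span_fibrewise D phi : down_closed D -> phi \in last_exps_span D ->
  fibrewise e iota chi D phi.
Proof.
move=> dD; apply: fibrewise_span => // x; rewrite mem_cat => /orP[] /imageP[j].
  by rewrite inE => Dj ->; apply: twisted_f_fibrewise.
rewrite inE => Dj ->; rewrite twist_foo -[X in fibrewise _ _ _ _ X]addr0.
apply: (fibrewise_lin pr_p card_k); last exact: fibrewise0.
apply: (fibrewise_stable pr_p card_k); apply: twisted_f_fibrewise => //.
by rewrite zero_first_last.
Qed.

Lemma twisted_f_in_span D j : D (j il) -> twisted_f j \in last_exps_span D.
Proof.
by move=> Dj; apply: memv_span; rewrite mem_cat image_f ?inE.
Qed.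

Lemma w_twisted_f_in_span D j : D (j il) -> j i0 = exps0 f pr_p ->
  rtrans (gl_w R) (twisted_f j) \in last_exps_span D.
Proof.
move=> Dj j0.
have -> : rtrans (gl_w R) (twisted_f j) = det_pow red iota s (gl_w R) *: twist (fooj j).
  by rewrite twist_foo scalerA divff ?det_pow_neq0 // scale1r zero_first_id.
apply/memvZ/memv_span; rewrite mem_cat; apply/orP; right.
by apply: image_f; rewrite inE.
Qed.

(** The transversal of the affine chart on which the twisted f_j is a constant
    times a monomial in the digits. *)
Definition affine_pt (l : R) : {'GL_2[R]} := (gl_lam l)^-1%g.

Lemma twisted_f_affine_pt j d :
  twisted_f j (affine_pt (undig d)) = iota (red (-1)) ^+ s * digit_monomial iota d j.
Proof.
rewrite twistE f_affine /affine_pt !gl_lamVE !mx2E ?rmorph1 ?oner_neq0 // expr1n mul1r.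
rewrite /affine_coord gl_lamVE !mx2E divr1 opprK undigK; congr (_ ^+ s * _).
by rewrite /det_pow gl_lamVE det_mx22 !mx2E mul0r sub0r mulr1.
Qed.

(** On the affine chart, a change of the last digit is a move along a fibre, so
    that the exponents of the last digit in the interpolation formula satisfy D. *)
Lemma affine_expansion D phi : down_closed D -> fibrewise e iota chi D phi ->
  exists2 c : mexps -> E, (forall j, ~~ D (j il) -> c j = 0) &
    forall d, phi (affine_pt (undig d)) = \sum_j c j * twisted_f j (affine_pt (undig d)).
Proof.
move=> dD [hi hf]; pose F d : E := phi (affine_pt (undig d)).
pose kap : E := iota (red (-1)) ^+ s.
have kap0 : kap != 0.
  by rewrite expf_neq0 // fmorph_eq0 rmorphN rmorph1 oppr_eq0 oner_eq0.
exists (fun j => kap^-1 * digit_coef iota F j) => [j nDj|d].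
  rewrite (digit_coef_eq0 pr_p card_k _ nDj) ?mulr0 // => d a nDa.
  have hD := exps_in_affine pr_p card_k (d il) (-1) dD (hf (affine_pt (undig d))).
  rewrite -(hD a nDa); apply: (eq_coef pr_p card_k) => y; rewrite /F /fibre /affine_pt.
  by rewrite gl_low_lamV undig_last mulrN1 -opprB (small_opp ext).
rewrite -[LHS]/(F d) (digit_interpolation pr_p card_k iota F d); apply: eq_bigr => j _.
by rewrite twisted_f_affine_pt mulrACA mulVf // mul1r.
Qed.

Lemma eq_on_affine_pt phi psi g : phi \in in_ind chi -> psi \in in_ind chi ->
  red (GLval g 1 0) != 0 ->
  phi (affine_pt (affine_coord g)) = psi (affine_pt (affine_coord g)) ->
  phi g = psi g.
Proof.
move=> /in_indP h1 /in_indP h2 g0 e12; rewrite -[g](mulgK (gl_lam (affine_coord g))).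
have bB : (g * gl_lam (affine_coord g))%g \in borel R.
  rewrite gl_lam_borel /affine_coord mulrN mulrCA divrr ?mulr1 ?addNr //.
  by rewrite (small_unitE ext).
by rewrite h1 // h2 // -/(affine_pt _) e12.
Qed.

(** The points outside of the affine chart are exchanged by w with the points
    whose coordinate has first digit 0, where only the monomials without the
    first digit survive: they correspond to the f_(oo, ...).  Once phi is
    corrected by those, it vanishes outside of the chart, as do the f_j, and
    its expansion on the chart is an equality of functions. *)
Lemma fibrewise_in_span D phi : down_closed D -> fibrewise e iota chi D phi ->
  phi \in last_exps_span D.
Proof.
move=> dD hphi.
have hw := fibrewise_stable pr_p card_k (gl_w R) hphi.
have [c cD cE] := affine_expansion dD hw.
pose u : glfun R E := \sum_(j : mexps | j i0 == exps0 f pr_p) c j *: twisted_f j.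
have uD : u \in last_exps_span D.
  apply: memv_suml => j _; have [Dj|/cD ->] := boolP (D (j il)); last by rewrite scale0r mem0v.
  by apply/memvZ/twisted_f_in_span.
have wuD : rtrans (gl_w R) u \in last_exps_span D.
  have -> : rtrans (gl_w R) u =
      \sum_(j : mexps | j i0 == exps0 f pr_p) c j *: rtrans (gl_w R) (twisted_f j).
    apply/ffunP => g; rewrite ffunE !sum_ffunE; apply: eq_bigr => j _.
    by rewrite !ffunE.
  apply: memv_suml => j /eqP j0.
  have [Dj|/cD ->] := boolP (D (j il)); last by rewrite scale0r mem0v.
  by apply/memvZ/w_twisted_f_in_span.
have hu := last_exps_span_fibrewise dD uD.
have hwu := last_exps_span_fibrewise dD wuD.
(* Here g * w lies in the affine chart, and its coordinate has first digit 0. *)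
have boundary g : red (GLval g 1 0) = 0 -> phi g = rtrans (gl_w R) u g.
  move=> g0; rewrite ffunE.
  have -> : phi g = rtrans (gl_w R) phi (g * gl_w R)%g.
    by rewrite ffunE -mulgA gl_wK mulg1.
  have E10 : GLval (g * gl_w R)%g 1 0 = GLval g 1 1.
    by rewrite GLmulE !mx2E mulr0 mulr1 add0r.
  have E11 : GLval (g * gl_w R)%g 1 1 = GLval g 1 0.
    by rewrite GLmulE !mx2E mulr0 mulr1 addr0.
  have g1 := unit_bottom_row g0.
  apply: eq_on_affine_pt; rewrite ?E10 ?hw.1 ?hu.1 //.
  set d := dig (affine_coord (g * gl_w R)%g); have d0 : d i0 = 0.
    rewrite -red_undig digK /affine_coord E10 E11 rmorphN rmorphM g0 mul0r oppr0 //.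
  rewrite -[affine_coord _]digK -/d cE sum_ffunE [RHS]big_mkcond /=; apply: eq_bigr => j _.
  (* As 0^0 = 1, the terms that survive are those that define u. *)
  case: eqP => [_|j0]; first by rewrite [RHS]ffunE.
  rewrite twisted_f_affine_pt /digit_monomial (bigD1 i0) //= d0 rmorph0 expr0n.
  rewrite -(wt_exps0 f pr_p) (inj_eq (wt_inj pr_p)); case: eqP => // _.
  by rewrite mul0r !mulr0.
pose phi2 := phi - rtrans (gl_w R) u.
have h2 : fibrewise e iota chi D phi2.
  by rewrite /phi2 -scaleN1r addrC; apply: (fibrewise_lin pr_p card_k).
have [c2 c2D c2E] := affine_expansion dD h2.
have u2D : \sum_j c2 j *: twisted_f j \in last_exps_span D.
  apply: memv_suml => j _; have [Dj|/c2D ->] := boolP (D (j il)); last by rewrite scale0r mem0v.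
  by apply/memvZ/twisted_f_in_span.
suff : phi2 = \sum_j c2 j *: twisted_f j.
  by move=> /(congr1 (fun x => x + rtrans (gl_w R) u)); rewrite subrK => ->; apply: memvD.
apply/ffunP => g; have [g0|g0] := eqVneq (red (GLval g 1 0)) 0.
  rewrite !ffunE boundary // ffunE subrr sum_ffunE big1 // => j _.
  by rewrite ffunE twistE f_infinity // mulr0 scaler0.
apply: eq_on_affine_pt => //; first exact: h2.1.
  exact: (last_exps_span_fibrewise dD u2D).1.
rewrite -[affine_coord g]digK c2E sum_ffunE; apply: eq_bigr => j _.
by rewrite [RHS]ffunE.
Qed.

Lemma last_exps_spanP D phi : down_closed D ->
  phi \in last_exps_span D <-> fibrewise e iota chi D phi.
Proof. by move=> dD; split; [apply: last_exps_span_fibrewise | apply: fibrewise_in_span]. Qed.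

End Generators.

(** * Digit expansions in a discrete valuation ring *)
Section DigitExpansions.
Variables (O : comNzRingType) (k : finFieldType) (pik : {rmorphism O -> k}).
Variables (varpi : O) (teich : k -> O).
Hypothesis teichK : cancel teich pik.
Hypothesis pik_ker : forall x, pik x = 0 <-> exists y, x = varpi * y.
Hypothesis varpi_reg : GRing.lreg varpi.
Hypothesis pik_unit : forall x, pik x != 0 -> exists y, x * y = 1.

Lemma pik_varpi : pik varpi = 0.
Proof. by apply/pik_ker; exists 1; rewrite mulr1. Qed.

Lemma pik_eq x y : pik x = pik y <-> exists z, x = y + varpi * z.
Proof.
split=> [xy|[z ->]]; last by rewrite rmorphD rmorphM pik_varpi mul0r addr0.
have /pik_ker[z zE] : pik (x - y) = 0 by rewrite rmorphB xy subrr.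
by exists z; rewrite -zE addrC subrK.
Qed.

Definition expansion (d : nat -> k) m : O := \sum_(i < m) teich (d i) * varpi ^+ i.

Lemma expansion_recl d m :
  expansion d m.+1 = teich (d 0%N) + varpi * expansion (fun i => d i.+1) m.
Proof.
rewrite /expansion big_ord_recl expr0 mulr1 mulr_sumr; congr (_ + _).
by apply: eq_bigr => i _; rewrite /= exprS mulrCA.
Qed.

Lemma expansion_exists m x : exists d y, x = expansion d m + varpi ^+ m * y.
Proof.
elim: m x => [|m IHm] x.
  by exists (fun=> 0), x; rewrite /expansion big_ord0 add0r expr0 mul1r.
have /pik_eq[z ->] : pik x = pik (teich (pik x)) by rewrite teichK.
have [d [y ->]] := IHm z.
exists (fun i => if i is i'.+1 then d i' else pik x), y.
by rewrite expansion_recl /= exprS mulrDr addrA mulrA.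
Qed.

(** Reduction modulo varpi determines the first digit, which can then be
    subtracted to divide by varpi. *)
Lemma expansion_uniq m d d' y :
  expansion d m = expansion d' m + varpi ^+ m * y -> forall i, (i < m)%N -> d i = d' i.
Proof.
elim: m d d' => // m IHm d d'; rewrite !expansion_recl exprS -addrA -mulrA -mulrDr => e.
have e0 : d 0%N = d' 0%N.
  have /(congr1 pik) := e; rewrite !rmorphD !rmorphM pik_varpi !mul0r !addr0.
  by rewrite !teichK.
move: e; rewrite e0 => /addrI /varpi_reg /IHm h [//|i]; exact: h.
Qed.

Variables (R R' : finComUnitRingType) (n : nat).
Variables (pi : {rmorphism O -> R}) (pi' : {rmorphism O -> R'}).
Hypothesis n_gt0 : (0 < n)%N.
Hypothesis pi_surj : forall a, exists x, pi x = a.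
Hypothesis pi_ker : forall x, pi x = 0 <-> exists y, x = varpi ^+ n * y.
Hypothesis pi'_surj : forall a, exists x, pi' x = a.
Hypothesis pi'_ker : forall x, pi' x = 0 <-> exists y, x = varpi ^+ n.-1 * y.
Variables (rho : {rmorphism R -> R'}) (red : {rmorphism R -> k}).
Variable red' : {rmorphism R' -> k}.
Hypothesis rhoP : forall x, rho (pi x) = pi' x.
Hypothesis redP : forall x, red (pi x) = pik x.
Hypothesis red'P : forall x, red' (pi' x) = pik x.

Definition top_digit (y : k) : R := pi (varpi ^+ n.-1 * teich y).

(** Multiplication by varpi^(n-1) only remembers the residue class modulo
    varpi; this makes y |-> [y] varpi^(n-1) additive although the Teichmuller
    lift is not. *)
Lemma pi_top x y : pi (varpi ^+ n.-1 * x) = pi (varpi ^+ n.-1 * y) <-> pik x = pik y.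
Proof.
have vn z : varpi ^+ n * z = varpi ^+ n.-1 * (varpi * z).
  by rewrite mulrA -exprSr prednK.
rewrite pik_eq; split=> [xy|[z ->]].
  have /pi_ker[z] : pi (varpi ^+ n.-1 * x - varpi ^+ n.-1 * y) = 0.
    by rewrite rmorphB xy subrr.
  rewrite -mulrBr vn => /(lregX varpi_reg) zE.
  by exists z; rewrite -zE addrC subrK.
rewrite mulrDr rmorphD -vn (_ : pi (varpi ^+ n * z) = 0) ?addr0 //.
by apply/pi_ker; exists z.
Qed.

Lemma pi_topE x : pi (varpi ^+ n.-1 * x) = top_digit (pik x).
Proof. by apply/pi_top; rewrite teichK. Qed.

Lemma top_digit_small : small_extension rho red red' top_digit.
Proof.
split.
- by move=> x; have [X <-] := pi_surj x; rewrite rhoP redP red'P.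
- by move=> x'; have [X <-] := pi'_surj x'; exists (pi X).
- move=> x; have [X <-] := pi_surj x; rewrite redP => /pik_unit[Y XY].
  by apply/unitrPr; exists (pi Y); rewrite -rmorphM XY rmorph1.
- by move=> y z; rewrite /top_digit -rmorphD -mulrDr; apply/pi_top; rewrite rmorphD !teichK.
- move=> x y; have [X <-] := pi_surj x; rewrite redP /top_digit -rmorphM mulrCA.
  by apply/pi_top; rewrite rmorphM !teichK.
- move=> x; split=> [|[y ->]]; last by rewrite rhoP; apply/pi'_ker; exists (teich y).
  have [X <-] := pi_surj x; rewrite rhoP => /pi'_ker[Y ->].
  by exists (pik Y); apply: pi_topE.
- by move=> y z /pi_top; rewrite !teichK.
Qed.

Definition undigits (d : {ffun 'I_n -> k}) : R := pi (\sum_(i < n) teich (d i) * varpi ^+ i).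

Lemma undigits_inj : injective undigits.
Proof.
pose ext (d : {ffun 'I_n -> k}) (i : nat) : k := oapp d 0 (insub i).
have extE d : undigits d = pi (expansion (ext d) n).
  by congr (pi _); apply: eq_bigr => i _; rewrite /ext valK.
move=> d d'; rewrite !extE => dd'.
have /pi_ker[y] : pi (expansion (ext d) n - expansion (ext d') n) = 0.
  by rewrite rmorphB dd' subrr.
move/eqP; rewrite subr_eq addrC => /eqP /expansion_uniq h; apply/ffunP => i.
by have := h i (ltn_ord i); rewrite /ext valK.
Qed.

Lemma digitsK : cancel (digits pi teich varpi n) undigits.
Proof.
move=> l; rewrite /digits; case: pickP => [d /eqP -> //|none].
have [x xl] := pi_surj l; have [d [y xE]] := expansion_exists n x.
have := none [ffun i : 'I_n => d i]; rewrite -xl xE rmorphD.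
rewrite (_ : pi (varpi ^+ n * y) = 0) ?addr0; last by apply/pi_ker; exists y.
move/eqP; case; congr (pi _); apply: eq_bigr => i _; by rewrite ffunE.
Qed.

Lemma undigitsK : cancel undigits (digits pi teich varpi n).
Proof. by move=> d; apply: undigits_inj; rewrite digitsK. Qed.

Lemma undigits_last (il : 'I_n) d y : il = n.-1 :> nat ->
  undigits (set_dig d il y) = undigits d + top_digit (y - d il).
Proof.
move=> ilE; rewrite /undigits (bigD1 il) //= [in RHS](bigD1 il) //= !rmorphD addrAC.
congr (_ + _); last first.
  by congr (pi _); apply: eq_bigr => i ni; rewrite ffunE (negbTE ni).
rewrite ffunE eqxx /top_digit -rmorphD !(mulrC (teich _)) ilE -mulrDr; apply/pi_top.
by rewrite rmorphD !teichK addrC subrK.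
Qed.

Lemma red_undigits (i0 : 'I_n) d : i0 = 0%N :> nat -> red (undigits d) = d i0.
Proof.
move=> i0E; rewrite redP rmorph_sum (bigD1 i0) //= i0E expr0 mulr1 teichK.
rewrite big1 ?addr0 // => i ii0; rewrite rmorphM rmorphXn pik_varpi expr0n.
by rewrite -i0E (inj_eq val_inj) (negbTE ii0) mulr0.
Qed.

End DigitExpansions.

(** * The valuation ring *)
Section ValuationArithmetic.
Variables (F : fieldType) (v : valuation F) (varpi : vring v).
Hypotheses (varpi_neq0 : varpi != 0) (v_varpi : v (vring_val varpi) = 1).

Lemma valn1 : v 1 = 0.
Proof. by apply: (addrI (v 1)); rewrite -valnM ?oner_neq0 // mulr1 addr0. Qed.

Lemma valnV x : x != 0 -> v x^-1 = - v x.
Proof.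
by move=> x0; apply/eqP; rewrite -addr_eq0 -valnM ?invr_eq0 // mulVf // valn1.
Qed.

Lemma vring_val_eq0 (x : vring v) : (vring_val x == 0) = (x == 0).
Proof. by rewrite -(inj_eq val_inj). Qed.

Lemma vring_inj : injective (@vring_val F v).
Proof. exact: val_inj. Qed.

Lemma vringM (x y : vring v) : vring_val (x * y) = vring_val x * vring_val y.
Proof. by []. Qed.

Lemma vring_ge0 (x : vring v) : x != 0 -> 0 <= v (vring_val x).
Proof.
by rewrite -vring_val_eq0; case: x => x /= /orP[->|].
Qed.

Lemma vring_mulI (x : vring v) : x != 0 -> GRing.lreg x.
Proof.
move=> x0 y z /(congr1 (@vring_val _ _)); rewrite !vringM => h; apply: vring_inj.
by apply: mulfI h; rewrite vring_val_eq0.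
Qed.

Lemma varpiX_val m : vring_val (varpi ^+ m) != 0 /\ v (vring_val (varpi ^+ m)) = m%:Z.
Proof.
elim: m => [|m [IH0 IHv]]; first by rewrite expr0 oner_neq0 valn1.
have p0 : vring_val varpi != 0 by rewrite vring_val_eq0.
rewrite exprS vringM mulf_neq0 // valnM // v_varpi IHv; split=> //.
Qed.

Lemma in_mpowP m (x : vring v) : x \in in_mpow m <-> exists y, x = varpi ^+ m * y.
Proof.
have [m0 vm] := varpiX_val m; split=> [|[y ->]].
  have [->|x0 /orP[/eqP x0'|vx]] := eqVneq x 0; first by exists 0; rewrite mulr0.
    by rewrite x0' eqxx in x0.
  have yP : vring_val x / vring_val (varpi ^+ m) \in in_vring v.
    rewrite unfold_in; apply/orP; right.
    by rewrite valnM ?invr_eq0 ?vring_val_eq0 // valnV // vm subr_ge0.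
  by exists (VRing yP); apply: vring_inj; rewrite vringM /= mulrC divfK.
rewrite unfold_in -vring_val_eq0 vringM mulf_eq0 (negbTE m0) /=.
have [->//|y0] := eqVneq (vring_val y) 0.
by rewrite valnM // vm lerDl vring_ge0 // -vring_val_eq0.
Qed.

Lemma vring_inv (x : vring v) : x \notin in_mpow 1 -> exists y, x * y = 1.
Proof.
rewrite unfold_in negb_or => /andP[x0 x1].
have vx : v (vring_val x) = 0.
  apply/eqP; rewrite eq_le vring_ge0 // andbT; move: x1; rewrite -ltNge.
  by case: (v _) => [[|m]|m].
have yP : (vring_val x)^-1 \in in_vring v.
  by rewrite unfold_in valnV ?vring_val_eq0 // vx oppr0 lexx orbT.
by exists (VRing yP); apply: vring_inj; rewrite vringM /= divff // vring_val_eq0.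
Qed.

End ValuationArithmetic.

(** * The isomorphism *)
Section FirstIsomorphism.
Variables (R : finComUnitRingType) (E : fieldType) (U V : {vspace glfun R E}).
Variables (hU : gstable U) (hV : gstable V) (N : gmod {'GL_2[R]} E).
Variable T : subvs_of U -> N.
Hypothesis T_lin : linear T.
Hypothesis T_ker : forall u, T u = 0 <-> vsval u \in V.
Hypothesis T_surj : forall w, exists u, T u = w.
Hypothesis T_act : forall g u, T (sub_act hU g u) = Defs.gact g (T u).
Local Notation Q := (quotv U V).
Local Open Scope quotient_scope.

Let T_sub u w : T u = T w <-> \pi_Q u = \pi_Q w.
Proof.
have -> : (T u = T w) <-> vsval u - vsval w \in V.
  rewrite -(linearB (@vsval _ _ U)) -T_ker -[u - w]addrC -scaleN1r T_lin scaleN1r addrC.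
  by split=> [->|/eqP]; [rewrite subrr | rewrite subr_eq0 => /eqP].
by rewrite -pi_quotv_eq; split=> [/eqP|->].
Qed.

Definition quot_map (x : Q) : N := T (generic_quotient.repr x).

Fact quot_mapE u : quot_map (\pi_Q u) = T u.
Proof. by apply/T_sub; rewrite reprK. Qed.

Fact quot_map_linear : linear quot_map.
Proof.
move=> a x y; rewrite -[x]reprK -[y]reprK -pi_quotv_linear !quot_mapE.
exact: T_lin.
Qed.
HB.instance Definition _ := GRing.isLinear.Build E Q N _ quot_map quot_map_linear.

Lemma subquot_iso : gmod_iso (subquot_gmod hU hV) N.
Proof.
have inj : injective quot_map.
  by move=> x y; rewrite -[x]reprK -[y]reprK !quot_mapE => /T_sub.
have ex w : exists x, quot_map x == w.
  by have [u <-] := T_surj w; exists (\pi_Q u); rewrite quot_mapE.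
pose inv w := xchoose (ex w).
have invK : cancel inv quot_map by move=> w; apply/eqP/(xchooseP (ex w)).
exists quot_map; split; first by exists inv => //; apply: inj_can_sym invK inj.
move=> g x; rewrite -[x]reprK -[Defs.gact g _](pi_sub_act hU hV) /=.
by rewrite !quot_mapE T_act.
Qed.

End FirstIsomorphism.

Theorem theorem1p1
  (p : nat) (pr_p : prime p) (odd_p : odd p)
  (* the finite extension F of Q_p, its normalized valuation v and the
     uniformizer varpi; vring v is the valuation ring *)
  (F : fieldExtType (padic pr_p)) (v : valuation F)
  (v_padic : forall x : padic pr_p,
     x%:A \in in_vring v <-> exists z : padic_int pr_p, x = FracField.tofrac z)
  (varpi : vring v) (varpi_neq0 : varpi != 0) (v_varpi : v (vring_val varpi) = 1)
  (* the residue field k, of cardinality p ^ f, and the Teichmuller lift *)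
  (k : finFieldType) (pik : {rmorphism vring v -> k})
  (pik_quot : is_quotient 1 pik)
  (f : nat) (card_k : #|k| = (p ^ f)%N)
  (teich : k -> vring v) (teichP : is_teichmuller pik teich)
  (* the coefficient field *)
  (E : fieldType) (iota : {rmorphism k -> E})
  (* R and R' are the quotients of the valuation ring modulo the n-th and the
     (n-1)-st power of the maximal ideal *)
  (n : nat) (n_ge2 : (2 <= n)%N)
  (R : finComUnitRingType) (pi : {rmorphism vring v -> R})
  (pi_quot : is_quotient n pi)
  (R' : finComUnitRingType) (pi' : {rmorphism vring v -> R'})
  (pi'_quot : is_quotient n.-1 pi')
  (rho : {rmorphism R -> R'}) (rhoP : forall x, rho (pi x) = pi' x)
  (red : {rmorphism R -> k}) (redP : forall x, red (pi x) = pik x)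
  (red' : {rmorphism R' -> k}) (red'P : forall x, red' (pi' x) = pik x)
  (* the character chi = det^s chi_r *)
  (chi : {'GL_2[R]} -> E) (chi_char : is_bchar chi)
  (s r : nat)
  (chiE : {in borel R, forall b, chi b = det_pow red iota s b * chi_ red iota r b}) :
  let W := W_ pi red iota teich varpi n pr_p s r in
  let chi' (beta : exps p f) (b : {'GL_2[R']}) :=
    det_pow red' iota s b * chi_ red' iota r b * iota (eta red' b ^+ wt beta) in
  exists hW : forall beta : exps p f, is_submodule_of_ind chi (W beta),
  forall beta : exps p f,
    gmod_iso
      (subquot_gmod (U := W beta)
         (V := (\sum_(alpha : exps p f | exps_lt alpha beta) W alpha)%VS)
         (hW beta).2 (gstable_sum (fun alpha => (hW alpha).2)))
      (inflation (gl_map1 rho) (gl_mapM rho) (ind_gmod (chi' beta))).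
Proof.
move=> W chi'.
have pik_ker x : pik x = 0 <-> exists y, x = varpi * y.
  have := in_mpowP varpi_neq0 v_varpi 1 x; rewrite expr1 -pik_quot.2 => <-.
  by split=> /eqP.
have pi_ker x : pi x = 0 <-> exists y, x = varpi ^+ n * y.
  by rewrite -(in_mpowP varpi_neq0 v_varpi) -pi_quot.2; split=> /eqP.
have pi'_ker x : pi' x = 0 <-> exists y, x = varpi ^+ n.-1 * y.
  by rewrite -(in_mpowP varpi_neq0 v_varpi) -pi'_quot.2; split=> /eqP.
have pik_unit x : pik x != 0 -> exists y, x * y = 1.
  by rewrite pik_quot.2; apply: vring_inv.
have teichK : cancel teich pik by move=> x; have [] := teichP x.
have reg := vring_mulI varpi_neq0.
have n_gt0 : (0 < n)%N := ltnW n_ge2.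
pose i0 : 'I_n := Ordinal n_gt0.
have il_lt : (n.-1 < n)%N by rewrite prednK.
pose il : 'I_n := Ordinal il_lt.
have i0l : i0 != il by rewrite -(inj_eq val_inj) /= eq_sym -lt0n -ltnS prednK.
pose e := top_digit varpi teich n pi.
have ext : small_extension rho red red' e.
  exact: (top_digit_small teichK pik_ker reg pik_unit n_gt0 pi_quot.1 pi_ker
    pi'_quot.1 pi'_ker rhoP redP red'P).
have digK := digitsK teichK pik_ker pi_quot.1 pi_ker.
have undigK := undigitsK teichK pik_ker reg pi_quot.1 pi_ker.
have undig_last d y :=
  undigits_last teichK pik_ker reg n_gt0 pi_ker d y (erefl : il = n.-1 :> nat).
have red_undig d := red_undigits teichK pik_ker redP d (erefl : i0 = 0%N :> nat).
have chiE' : {in borel R, forall b, chi b = borel_char red iota s r b} by exact: chiE.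
pose D_lt (beta a : exps p f) := exps_lt a beta.
have dle (beta : exps p f) : down_closed (below beta) by move=> a b; apply: exps_le_trans.
have dlt beta : down_closed (D_lt beta) by move=> a b; apply: exps_lt_le_trans.
have spanP (D : pred (exps p f)) phi : down_closed D ->
    phi \in last_exps_span pr_p red iota s r pi teich varpi il D <-> fibrewise e iota chi D phi.
  move=> dD.
  exact: (last_exps_spanP pr_p card_k ext chiE' (erefl : i0 = 0%N :> nat) i0l
    digK undigK undig_last red_undig).
have WE beta : W beta = last_exps_span pr_p red iota s r pi teich varpi il (below beta).
  exact: W_last_exps_span.
have WP beta phi : phi \in W beta <-> fibrewise e iota chi (below beta) phi.
  by rewrite WE; apply: spanP.
have hW (beta : exps p f) : is_submodule_of_ind chi (W beta).
  split=> [phi /WP[] //|g phi /WP hphi]; apply/WP.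
  exact: (fibrewise_stable pr_p card_k).
exists hW => beta.
have sumP phi : phi \in (\sum_(alpha : exps p f | exps_lt alpha beta) W alpha)%VS <->
    fibrewise e iota chi (D_lt beta) phi.
  rewrite -spanP //; split.
    case/memv_sumP => u hu ->; apply: memv_suml => a ab; apply/spanP => //.
    apply: fibrewise_sub (proj1 (WP a (u a)) (hu a ab)) => c ca.
    exact: exps_lt_le_trans ca ab.
  apply: subvP; apply/span_subvP => x hx; rewrite /last_exps_span.
  have [a ab xa] : exists2 a, exps_lt a beta & x \in W a.
    move: hx; rewrite mem_cat => /orP[] /imageP[j]; rewrite inE => jb ->;
      exists (j il) => //; rewrite WE; apply: memv_span; rewrite mem_cat;
      apply/orP; [left | right]; apply: image_f; rewrite inE; exact: exps_le_refl.
  by apply: (subvP (sumv_sup a ab (subvv _))).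
pose T (u : subvs_of (W beta)) : ind (chi' beta) :=
  Ind (top_coef_fun_ind pr_p card_k ext chiE' (proj1 (WP beta _) (subvsP u))).
have WF (u : subvs_of (W beta)) := proj1 (WP beta _) (subvsP u).
pose N := inflation (gl_map1 rho) (gl_mapM rho) (ind_gmod (chi' beta)).
apply: (@subquot_iso _ _ _ _ _ _ N T).
- move=> a u w; apply: val_inj; rewrite /T /=.
  exact: (top_coef_fun_lin pr_p card_k).
- move=> u; rewrite sumP -(top_coef_fun_eq0 pr_p card_k ext chiE' (WF u)).
  by split=> [/(congr1 val)|h]; last exact: val_inj.
- move=> w; have sw := proj2 (WP beta _) (spread_fibrewise pr_p card_k ext chiE' beta w).
  exists (Subvs sw); apply: val_inj.
  exact: (spreadK pr_p card_k ext chiE' (indP w)).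
- move=> g u; apply: val_inj; exact: (top_coef_fun_stable pr_p card_k ext chiE').
Qed.
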